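(* Let $\alpha>0$, $1<p<\infty$, $\frac1p+\frac1{p'}=1$, and let $\mathcal{G}_\alpha=\left\{z\mapsto\exp\left(\alpha az+\frac{\alpha}{2}cz^2\right)\colon a,c\in\mathbb C,\ |c|<1\right\}$ (functions on $\mathbb C$). Then \[ \sup_{g,h\in\mathcal{G}_\alpha}\mathcal{R}_{p,\alpha}(g,h)=\sqrt{C_p},\qquad \mathcal{R}_{p,\alpha}(g,h)=\frac{|\langle g,h\rangle_\alpha|}{\|g\|_{p,\alpha}\|h\|_{p',\alpha}}. \]
   Context: For $\alpha>0$, $\gamma^1_\alpha(dz)=(\alpha/\pi)e^{-\alpha|z|^2}\lambda(dz)$ on $\mathbb C$, with $\lambda$ Lebesgue measure. For $1\le q<\infty$, $\|f\|_{q,\alpha}:=\left(\int_{\mathbb C}|f|^q\,d\gamma^1_{\alpha q/2}\right)^{1/q}$. $\langle f,g\rangle_\alpha=\int_{\mathbb C} f\overline g\,d\gamma^1_\alpha$. $C_p=2\,p^{-1/p}\,(p')^{-1/p'}$. *)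

(* Defs.v *)
From HB Require Import structures.
From mathcomp Require Import all_boot all_order all_algebra.
From mathcomp Require Import all_classical all_reals all_analysis.
From mathcomp Require Import complex.
Set Implicit Arguments. Unset Strict Implicit. Unset Printing Implicit Defensive.
Import Order.TTheory GRing.Theory Num.Theory ComplexField.
Import numFieldNormedType.Exports.
Local Open Scope classical_set_scope.
Local Open Scope ring_scope.
Local Open Scope complex_scope.
Local Open Scope ring_scope.

Section Defs.
Variable R : realType.

(* Lebesgue measure on C, identified with R x R via (x,y) |-> x + i y. *)
Definition lamC := (@lebesgue_measure R \x @lebesgue_measure R)%E.
Definition toC (q : R * R) : R[i] := (q.1 +i* q.2)%C.

Definition cexp (w : R[i]) : R[i] :=
  (expR (complex.Re w) * cos (complex.Im w)) +i* (expR (complex.Re w) * sin (complex.Im w)).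

(* density of gamma^1_alpha w.r.t. Lebesgue measure, at z = x + i y *)
Definition gdens (alpha : R) (q : R * R) : R :=
  alpha / pi * expR (- alpha * (q.1 ^+ 2 + q.2 ^+ 2)).

Definition lpnorm (s alpha : R) (f : R[i] -> R[i]) : R :=
  (fine (\int[lamC]_(q in setT)
           ((Normc.normc (f (toC q))) `^ s * gdens (alpha * s / 2) q)%:E)) `^ s^-1.

Definition ipr (alpha : R) (f g : R[i] -> R[i]) : R[i] :=
  let F := fun q => f (toC q) * conjc (g (toC q)) * (gdens alpha q)%:C in
  (Rintegral lamC setT (fun q => complex.Re (F q)))
    +i* (Rintegral lamC setT (fun q => complex.Im (F q))).

Definition conjexp (p : R) : R := p / (p - 1).

Definition Cp (p : R) : R :=
  2 * p `^ (- p^-1) * (conjexp p) `^ (- (conjexp p)^-1).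

Definition gfun (alpha : R) (a c : R[i]) : R[i] -> R[i] :=
  fun z => cexp (alpha%:C * a * z + (alpha / 2)%:C * c * z ^+ 2).

Definition Galpha (alpha : R) : set (R[i] -> R[i]) :=
  [set g | exists a c : R[i], Normc.normc c < 1 /\ g = gfun alpha a c].

Definition Rratio (p alpha : R) (g h : R[i] -> R[i]) : R :=
  Normc.normc (ipr alpha g h) / (lpnorm p alpha g * lpnorm (conjexp p) alpha h).

End Defs.

(* Main.v *)
(** Every pairing of members of [Galpha] is a planar Gaussian integral with
complex quadratic form.  Write [delta] for the conjugate of [d], replace the
conjugate of the integration variable by an independent variable, and let
[(z, zeta)] be the critical point of the phase: [zeta = a + c z],
[z = conj b + delta zeta].  Then
  [<g, h>^2 (1 - c delta) = exp (alpha (a z + conj b zeta))],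
and [norm g] is the same integral with [h = g] and [alpha s / 2] in place of
[alpha].  Hence the squared ratio factors as an exponential times
  [(1 - |c|^2)^(1/p) (1 - |d|^2)^(1/p') / |1 - c delta|].
Comparing the complex critical value with the two real maxima bounds the
exponential by 1; weighted AM-GM bounds the second factor by [Cp p], and this is
sharp as [c] and [d] tend to 1 along [1 - e/p] and [1 - e/p'].

The complex Gaussian integral [J] of [exp (- A (x - w)^2)] comes from its moments:
along a path in [(A, w)] on which [Re A] is constant, [J^2 A] has derivative 0. *)

Require Import Defs.
From HB Require Import structures.
From mathcomp Require Import all_boot all_order all_algebra.
From mathcomp Require Import all_classical all_reals all_analysis.
From mathcomp Require Import measurable_realfun complex ring lra.
Import Order.TTheory GRing.Theory Num.Theory ComplexField.
Import numFieldNormedType.Exports.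
Local Open Scope classical_set_scope.
Local Open Scope ring_scope.
Local Open Scope complex_scope.
Local Open Scope ring_scope.

Set Implicit Arguments.
Unset Strict Implicit.
Unset Printing Implicit Defensive.

Local Notation Re := (@complex.Re _).
Local Notation Im := (@complex.Im _).
Local Notation normc := Normc.normc.

(** * Real and imaginary parts, modulus and exponential of complex numbers *)

Section ComplexParts.
Variable R : realType.
Implicit Types z w : R[i].

Lemma complex_eq z w : Re z = Re w -> Im z = Im w -> z = w.
Proof. by case: z w => [a b] [c d] /= -> ->. Qed.

Lemma ReD z w : Re (z + w) = Re z + Re w.
Proof. by case: z w => [a b] [c d]. Qed.
Lemma ImD z w : Im (z + w) = Im z + Im w.
Proof. by case: z w => [a b] [c d]. Qed.
Lemma ReN z : Re (- z) = - Re z.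
Proof. by case: z. Qed.
Lemma ImN z : Im (- z) = - Im z.
Proof. by case: z. Qed.
Lemma ReM z w : Re (z * w) = Re z * Re w - Im z * Im w.
Proof. by case: z w => [a b] [c d]. Qed.
Lemma ImM z w : Im (z * w) = Re z * Im w + Im z * Re w.
Proof. by case: z w => [a b] [c d]. Qed.
Lemma ReJ z : Re (conjc z) = Re z.
Proof. by case: z. Qed.
Lemma ImJ z : Im (conjc z) = - Im z.
Proof. by case: z. Qed.
Lemma Re0 : Re (0 : R[i]) = 0. Proof. by []. Qed.
Lemma Im0 : Im (0 : R[i]) = 0. Proof. by []. Qed.
Lemma Re1 : Re (1 : R[i]) = 1. Proof. by []. Qed.
Lemma Im1 : Im (1 : R[i]) = 0. Proof. by []. Qed.
Lemma ReC (x : R) : Re x%:C = x. Proof. by []. Qed.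
Lemma ImC (x : R) : Im x%:C = 0. Proof. by []. Qed.

Lemma realCM (x y : R) : (x * y)%:C = x%:C * y%:C. Proof. exact: rmorphM. Qed.

Lemma conjcD z w : conjc (z + w) = conjc z + conjc w. Proof. exact: rmorphD. Qed.
Lemma conjcM z w : conjc (z * w) = conjc z * conjc w. Proof. exact: rmorphM. Qed.

(** With [expr2] included, squares become products before [ReM] and [ImM] apply, so an identity in
    [R[i]] reduces to polynomial identities in [R]. *)
Definition ReImE := (expr2, ReD, ImD, ReN, ImN, ReM, ImM, ReJ, ImJ,
  Re0, Im0, Re1, Im1, ReC, ImC).

Lemma normcE z : normc z = Num.sqrt (Re z ^+ 2 + Im z ^+ 2).
Proof. by case: z. Qed.

Lemma normc_ge0 z : 0 <= normc z.
Proof. by rewrite normcE sqrtr_ge0. Qed.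

Lemma normc_sqr z : normc z ^+ 2 = Re z ^+ 2 + Im z ^+ 2.
Proof. by rewrite normcE sqr_sqrtr// addr_ge0// sqr_ge0. Qed.

Lemma ler_normc_Re z : `|Re z| <= normc z.
Proof.
by rewrite -ler_sqr ?nnegrE ?normc_ge0// normc_sqr real_normK ?num_real// lerDl sqr_ge0.
Qed.

Lemma ler_normc_Im z : `|Im z| <= normc z.
Proof.
by rewrite -ler_sqr ?nnegrE ?normc_ge0// normc_sqr real_normK ?num_real// lerDr sqr_ge0.
Qed.

Lemma normcJ z : normc (conjc z) = normc z.
Proof. by rewrite !normcE ReJ ImJ sqrrN. Qed.

Lemma normc_real (x : R) : normc x%:C = `|x|.
Proof. by rewrite normcE ReC ImC expr0n addr0 sqrtr_sqr. Qed.

Lemma normc1 : normc (1 : R[i]) = 1.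
Proof. by rewrite normcE Re1 Im1 expr1n expr0n addr0 sqrtr1. Qed.

Lemma normc_eq0 z : (normc z == 0) = (z == 0).
Proof.
by apply/eqP/eqP => [/Normc.eq0_normc//|->]; rewrite Normc.normc0.
Qed.

Lemma cexpD z w : cexp (z + w) = cexp z * cexp w.
Proof.
by apply: complex_eq; rewrite /cexp ?(ReM, ImM) /= !(ReD, ImD) expRD ?cosD ?sinD; ring.
Qed.

Lemma normc_cexp z : normc (cexp z) = expR (Re z).
Proof.
rewrite normcE /= !exprMn -mulrDr cos2Dsin2 mulr1 sqrtr_sqr.
by rewrite ger0_norm// expR_ge0.
Qed.

Lemma conjc_cexp z : conjc (cexp z) = cexp (conjc z).
Proof. by apply: complex_eq; rewrite ?(ReJ, ImJ) /= !(ReJ, ImJ) ?(cosN, sinN) ?mulrN. Qed.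

Lemma cexp_real (x : R) : cexp x%:C = (expR x)%:C.
Proof. by rewrite /cexp /= cos0 sin0 mulr1 mulr0. Qed.

Lemma cexp_sqr z : cexp z ^+ 2 = cexp (z *+ 2).
Proof. by rewrite mulr2n cexpD expr2. Qed.

End ComplexParts.

(** * Derivatives of complex-valued functions of a real variable *)

Section ComplexDerivative.
Variable R : realType.
Implicit Types f g : R -> R[i].

(** The derivative is taken part by part, so that the real chain rule, mean value argument and
    fundamental theorem apply directly. *)
Definition is_cderive (t : R) f (df : R[i]) : Prop :=
  is_derive t 1 (Re \o f) (Re df) /\ is_derive t 1 (Im \o f) (Im df).

Lemma is_cderive_eq t f df df' : is_cderive t f df -> df = df' -> is_cderive t f df'.
Proof. by move=> ? <-. Qed.

Lemma is_cderive_cst (t : R) (k : R[i]) : is_cderive t (cst k) 0.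
Proof. by split; exact: is_derive_cst. Qed.

Lemma is_cderive_real (t : R) : is_cderive t (fun x => x%:C) 1.
Proof. by split; [exact: is_derive_id|exact: is_derive_cst]. Qed.

Lemma is_cderiveD t f g df dg : is_cderive t f df -> is_cderive t g dg ->
  is_cderive t (fun x => f x + g x) (df + dg).
Proof.
move=> [f1 f2] [g1 g2]; split.
  rewrite ReD; have -> : Re \o (fun x => f x + g x) = (Re \o f) \+ (Re \o g).
    by apply/funext => x /=; rewrite ReD.
  exact: is_deriveD.
rewrite ImD; have -> : Im \o (fun x => f x + g x) = (Im \o f) \+ (Im \o g).
  by apply/funext => x /=; rewrite ImD.
exact: is_deriveD.
Qed.

Lemma is_cderiveN t f df : is_cderive t f df -> is_cderive t (fun x => - f x) (- df).
Proof.
move=> [f1 f2]; split.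
  rewrite ReN; have -> : Re \o (fun x => - f x) = \- (Re \o f).
    by apply/funext => x /=; rewrite ReN.
  exact: is_deriveN.
rewrite ImN; have -> : Im \o (fun x => - f x) = \- (Im \o f).
  by apply/funext => x /=; rewrite ImN.
exact: is_deriveN.
Qed.

Lemma is_cderiveM t f g df dg : is_cderive t f df -> is_cderive t g dg ->
  is_cderive t (fun x => f x * g x) (df * g t + f t * dg).
Proof.
move=> [f1 f2] [g1 g2]; split.
  have -> : Re \o (fun x => f x * g x) =
      (Re \o f) * (Re \o g) - (Im \o f) * (Im \o g).
    by apply/funext => x /=; rewrite ReM.
  apply: is_derive_eq; rewrite /= /GRing.scale /= !ReImE; ring.
have -> : Im \o (fun x => f x * g x) =
    (Re \o f) * (Im \o g) + (Im \o f) * (Re \o g).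
  by apply/funext => x /=; rewrite ImM.
apply: is_derive_eq; rewrite /= /GRing.scale /= !ReImE; ring.
Qed.

Lemma is_cderive_cexp t f df : is_cderive t f df ->
  is_cderive t (fun x => cexp (f x)) (df * cexp (f t)).
Proof.
move=> [f1 f2].
have h1 : is_derive t 1 (expR \o (Re \o f)) (expR (Re (f t)) * Re df).
  exact: is_derive1_comp.
have h2 : is_derive t 1 (cos \o (Im \o f)) (- sin (Im (f t)) * Im df).
  exact: is_derive1_comp.
have h3 : is_derive t 1 (sin \o (Im \o f)) (cos (Im (f t)) * Im df).
  exact: is_derive1_comp.
split.
  have -> : Re \o (fun x => cexp (f x)) =
    (expR \o (Re \o f)) * (cos \o (Im \o f)) by apply/funext.
  apply: is_derive_eq; rewrite /= /GRing.scale /= !ReM /=; ring.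
have -> : Im \o (fun x => cexp (f x)) =
  (expR \o (Re \o f)) * (sin \o (Im \o f)) by apply/funext.
apply: is_derive_eq; rewrite /= /GRing.scale /= !ImM /=; ring.
Qed.

Lemma is_cderive_continuous f (df : R -> R[i]) : (forall t, is_cderive t f (df t)) ->
  continuous (Re \o f) /\ continuous (Im \o f).
Proof.
move=> h; split=> t; have [h1 h2] := h t;
  apply: differentiable_continuous; apply/derivable1_diffP; exact: ex_derive.
Qed.

(** Transport principle for the Gaussian integrals below: a quantity with zero derivative along a
    parameter path agrees at the two ends of the path. *)
Lemma is_cderive0_cst f : (forall t, is_cderive t f 0) -> forall x y, f x = f y.
Proof.
move=> h x y; apply: complex_eq.
  by apply: (@is_derive_0_is_cst R (Re \o f)) => t; have [] := h t.
by apply: (@is_derive_0_is_cst R (Im \o f)) => t; have [] := h t.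
Qed.

End ComplexDerivative.

(** * Integrals of complex-valued functions and differentiation under the integral sign *)

Section ComplexIntegral.
Context d (T : measurableType d) (R : realType).
Variable mu : {measure set T -> \bar R}.
Implicit Types f g : T -> R[i].

(** Has the shape of [ipr], so that a pairing is a [cint] by conversion. *)
Definition cint f : R[i] :=
  Rintegral mu setT (Re \o f) +i* Rintegral mu setT (Im \o f).

Definition cintegrable f : Prop :=
  mu.-integrable setT (EFin \o (Re \o f)) /\ mu.-integrable setT (EFin \o (Im \o f)).

Lemma cintegrableD f g : cintegrable f -> cintegrable g ->
  cintegrable (fun x => f x + g x).
Proof.
move=> [f1 f2] [g1 g2]; split.
  have -> : EFin \o (Re \o (fun x => f x + g x)) =
      ((EFin \o (Re \o f)) \+ (EFin \o (Re \o g)))%E.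
    by apply/funext => x /=; rewrite ReD EFinD.
  exact: integrableD.
have -> : EFin \o (Im \o (fun x => f x + g x)) =
    ((EFin \o (Im \o f)) \+ (EFin \o (Im \o g)))%E.
  by apply/funext => x /=; rewrite ImD EFinD.
exact: integrableD.
Qed.

Lemma cintD f g : cintegrable f -> cintegrable g ->
  cint (fun x => f x + g x) = cint f + cint g.
Proof.
move=> [f1 f2] [g1 g2]; apply: complex_eq; rewrite ?(ReD, ImD) /cint /=.
  rewrite -RintegralD//; apply: eq_Rintegral => x _ /=; exact: ReD.
rewrite -RintegralD//; apply: eq_Rintegral => x _ /=; exact: ImD.
Qed.

(** Both parts of [k * f] are real linear combinations of the parts of [f]; this settles scalar
    multiplication for both at once. *)
Let integrable_lincomb (u v : T -> R) (r s : R) :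
  mu.-integrable setT (EFin \o u) -> mu.-integrable setT (EFin \o v) ->
  mu.-integrable setT (EFin \o (fun x => r * u x + s * v x)) /\
  Rintegral mu setT (fun x => r * u x + s * v x) =
  r * Rintegral mu setT u + s * Rintegral mu setT v.
Proof.
move=> iu iv.
have iru : mu.-integrable setT (EFin \o (fun x => r * u x)).
  have -> : EFin \o (fun x => r * u x) = (fun x => r%:E * (EFin \o u) x)%E.
    by apply/funext => x /=; rewrite EFinM.
  exact: integrableZl.
have isv : mu.-integrable setT (EFin \o (fun x => s * v x)).
  have -> : EFin \o (fun x => s * v x) = (fun x => s%:E * (EFin \o v) x)%E.
    by apply/funext => x /=; rewrite EFinM.
  exact: integrableZl.
split; last by rewrite RintegralD// !RintegralZl.
have -> : EFin \o (fun x => r * u x + s * v x) =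
   ((EFin \o (fun x => r * u x)%R) \+ (EFin \o (fun x => s * v x)%R))%E.
  by apply/funext => x /=; rewrite EFinD.
exact: integrableD.
Qed.

Let ReZ k f : Re \o (fun x => k * f x) =
  (fun x => Re k * (Re \o f) x + (- Im k) * (Im \o f) x).
Proof. by apply/funext => x /=; rewrite ReM mulNr. Qed.

Let ImZ k f : Im \o (fun x => k * f x) =
  (fun x => Im k * (Re \o f) x + Re k * (Im \o f) x).
Proof. by apply/funext => x /=; rewrite ImM addrC. Qed.

Lemma cintegrableZl k f : cintegrable f -> cintegrable (fun x => k * f x).
Proof.
move=> [f1 f2]; rewrite /cintegrable ReZ ImZ.
by split; apply: (integrable_lincomb _ _ _ _).1.
Qed.

Lemma cintZl k f : cintegrable f -> cint (fun x => k * f x) = k * cint f.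
Proof.
move=> [f1 f2]; rewrite [LHS]/cint ReZ ImZ !(integrable_lincomb _ _ _ _).2//.
by apply: complex_eq; rewrite ?(ReM, ImM) /=; ring.
Qed.

Lemma le_cintegrable f (G : T -> R) :
  measurable_fun setT (Re \o f) -> measurable_fun setT (Im \o f) ->
  mu.-integrable setT (EFin \o G) -> (forall x, normc (f x) <= G x) ->
  cintegrable f.
Proof.
move=> m1 m2 iG fG; split.
  apply: (le_integrable measurableT _ _ iG); first exact/measurable_EFinP.
  move=> x _ /=; rewrite lee_fin (le_trans (ler_normc_Re _))// (le_trans (fG _))//.
  exact: ler_norm.
apply: (le_integrable measurableT _ _ iG); first exact/measurable_EFinP.
move=> x _ /=; rewrite lee_fin (le_trans (ler_normc_Im _))// (le_trans (fG _))//.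
exact: ler_norm.
Qed.

(** Real differentiation under the integral sign is applied to each part. A bound on the modulus of
    [f'] dominates both parts, and it is asked for only on a window around [t]. *)
Lemma is_cderive_cint (f f' : R -> T -> R[i]) (t u v : R) (G : T -> R) :
  u < t < v ->
  (forall s, cintegrable (f s)) ->
  (forall s x, is_cderive s (f^~ x) (f' s x)) ->
  mu.-integrable setT (EFin \o G) ->
  (forall s x, u < s < v -> normc (f' s x) <= G x) ->
  is_cderive t (fun s => cint (f s)) (cint (f' t)).
Proof.
move=> tuv intf der iG fG.
have G0 x : 0 <= G x by rewrite (le_trans _ (fG t x tuv))// normc_ge0.
have It : `]u, v[%classic t by rewrite /= in_itv.
(* Here [p] stands for either the real or the imaginary part. *)
have key (p : R[i] -> R) : (forall z, `|p z| <= normc z) ->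
  (forall s, mu.-integrable setT (EFin \o (p \o f s))) ->
  (forall (s : R) x, is_derive s (1 : R) (fun s => p (f s x)) (p (f' s x))) ->
  is_derive t 1 (fun s => \int[mu]_x p (f s x)) (\int[mu]_x p (f' t x)).
  move=> pn ip dp.
  have d1 s x : partial1of2 (fun s x => p (f s x)) s x = p (f' s x).
    by rewrite partial1of2E; have [_] := dp s x.
  have h := @cvg_differentiation_under_integral R _ T mu (fun s x => p (f s x)) setT
    measurableT t u v It (fun x _ => ip x) _ G G0 iG _.
  have {h} : h^-1 *: (\int[mu]_y p (f (h + t) y) - \int[mu]_y p (f t y)) @[h --> 0^'] -->
      \int[mu]_y p (f' t y).
    rewrite (_ : \int[mu]_y p (f' t y) =
      \int[mu]_y partial1of2 (fun s x => p (f s x)) t y); last first.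
      by apply: eq_Rintegral => x _; rewrite d1.
    apply: h; first by move=> s x _ _; have [] := dp s x.
    move=> s x + _; rewrite /= in_itv /= => suv; rewrite d1.
    by rewrite (le_trans (pn _))// fG.
  move=> cv; apply: DeriveDef.
    apply/cvg_ex; exists (\int[mu]_y p (f' t y)) => /=.
    by under eq_fun do rewrite scaler1.
  apply/cvg_lim => //=.
  by under eq_fun do rewrite scaler1.
split.
  apply: key; [exact: ler_normc_Re|by move=> s; have [] := intf s|].
  by move=> s x; have [] := der s x.
apply: key; [exact: ler_normc_Im|by move=> s; have [] := intf s|].
by move=> s x; have [] := der s x.
Qed.

End ComplexIntegral.

(** * The real Gaussian: integrability, total mass and decay *)

Section RealGaussian.
Variable R : realType.
Local Notation leb := (@lebesgue_measure R).

(** The centred normal density of variance [1 / (2 a)] is proportional to this Gaussian, so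
    integrability and mass carry over from it. *)
Lemma gauss_pdfE (a x : R) : 0 < a -> expR (- (a * x ^+ 2)) =
  Num.sqrt (pi / a) * normal_pdf 0 (Num.sqrt (2 * a))^-1 x.
Proof.
move=> a0; have a2 : 0 < 2 * a by rewrite mulr_gt0.
have s2 : (Num.sqrt (2 * a))^-1 ^+ 2 = (2 * a)^-1.
  by rewrite exprVn sqr_sqrtr// ltW.
rewrite normal_pdfE ?invr_eq0 ?gt_eqF ?sqrtr_gt0// /normal_peak /normal_fun s2 subr0.
have -> : (2 * a)^-1 * pi *+ 2 = pi / a by field; lra.
rewrite mulVKf; last by rewrite gt_eqF// sqrtr_gt0 divr_gt0// pi_gt0.
by congr expR; field; lra.
Qed.

Lemma integrable_gauss (K a : R) : 0 < a ->
  leb.-integrable setT (EFin \o (fun x => K * expR (- (a * x ^+ 2)))).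
Proof.
move=> a0.
have -> : EFin \o (fun x => K * expR (- (a * x ^+ 2))) =
  (fun x => (K * Num.sqrt (pi / a))%:E *
            (normal_pdf 0 (Num.sqrt (2 * a))^-1 x)%:E)%E.
  by apply/funext => x /=; rewrite gauss_pdfE// mulrA -EFinM.
exact/integrableZl/integrable_normal_pdf.
Qed.

Lemma integral_gauss (a : R) : 0 < a ->
  (\int[leb]_x (expR (- (a * x ^+ 2)))%:E = (Num.sqrt (pi / a))%:E)%E.
Proof.
move=> a0; under eq_integral do rewrite gauss_pdfE// EFinM.
rewrite integralZl ?integral_normal_pdf ?mule1//.
exact: integrable_normal_pdf.
Qed.

Lemma cvg_gauss (K a : R) : 0 < a ->
  K * expR (- (a * n%:R ^+ 2)) @[n --> \oo] --> (0 : R).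
Proof.
move=> a0; rewrite -(mulr0 K); apply: cvgMr.
(* The comparison sequence is [2 / (a (n + 1))]: for [n >= 1], [exp (a n^2) >= 1 + a n^2 >= a (n +
   1) / 2]. *)
apply: (@squeeze_cvgr _ _ _ _ (cst 0) (fun n : nat => a^-1 * n.+1%:R^-1 *+ 2)).
- near=> n; rewrite expR_ge0 /= expRN.
  have n0 : (1 : R) <= n%:R by rewrite ler1n; near: n; exact: nbhs_infty_gt.
  rewrite -lef_pV2 ?posrE ?invr_gt0 ?expR_gt0 ?mulrn_wgt0 ?mulr_gt0 ?invr_gt0// invrK.
  apply: le_trans (expR_ge1Dx _).
  have -> : (a^-1 * n.+1%:R^-1 *+ 2)^-1 = a * (n%:R + 1) / 2 :> R.
    rewrite -natr1; field; lra.
  have h1 : 0 <= a * (n%:R * (n%:R - 1)).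
    by rewrite mulr_ge0 ?(ltW a0)// mulr_ge0// subr_ge0.
  have h2 : 0 <= a * (n%:R - 1) by rewrite mulr_ge0 ?subr_ge0// (ltW a0).
  lra.
- exact: cvg_cst.
- under eq_fun do rewrite -mulr_natl mulrA.
  rewrite -(mulr0 (2%:R * a^-1)); apply: cvgMr; exact: cvg_harmonic.
Unshelve. all: by end_near. Qed.

End RealGaussian.

(** * Integral over the line of a derivative whose primitive vanishes at infinity *)

Section DerivativeIntegral.
Variable R : realType.
Local Notation leb := (@lebesgue_measure R).

(** The fundamental theorem on [[-n, n]] leaves boundary terms that tend to 0, while dominated
    convergence, with [|f|] as bound, gives the full integral. *)
Lemma Rintegral_derive_eq0 (F f : R -> R) :
  (forall x : R, is_derive x (1 : R) F (f x)) -> continuous f ->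
  leb.-integrable setT (EFin \o f) ->
  F n%:R @[n --> \oo] --> (0 : R) -> F (- n%:R) @[n --> \oo] --> (0 : R) ->
  Rintegral leb setT f = 0.
Proof.
move=> dF cf intf F1 F2.
have mf : measurable_fun setT f by apply: continuous_measurable_fun.
pose fn n := (fun x => (f \_ `[- n%:R, n%:R] x)%:E) : R -> \bar R.
have fnE n : (\int[leb]_x fn n x = \int[leb]_(x in `[(- n%:R)%R, n%:R%R]) (f x)%:E)%E.
  rewrite [RHS]integral_mkcond; apply: eq_integral => x _.
  by rewrite /fn /patch; case: ifP.
(* The index [n.+1] keeps the interval nondegenerate; the shift is undone by [cvg_shiftn]. *)
have FTC n : (\int[leb]_x fn n.+1 x = (F n.+1%:R%R - F (- n.+1%:R)%R)%:E)%E.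
  rewrite fnE (@continuous_FTC2 _ _ F)//.
  - by rewrite ltrNl (@lt_trans _ _ 0)// oppr_lt0.
  - exact: continuous_subspaceT.
  - split.
    + by move=> x _; have [] := dF x.
    + apply: cvg_at_right_filter; apply: differentiable_continuous.
      by apply/derivable1_diffP; have [] := dF (- n.+1%:R).
    + apply: cvg_at_left_filter; apply: differentiable_continuous.
      by apply/derivable1_diffP; have [] := dF (n.+1%:R).
  - by move=> x _; rewrite derive1E; have [_] := dF x.
have cv : (\int[leb]_x fn n x @[n --> \oo] --> \int[leb]_x (f x)%:E)%E.
  apply: (@dominated_cvg _ _ _ leb setT measurableT fn _ (abse \o (EFin \o f))).
  - by move=> n; apply/measurable_EFinP; apply/(measurable_restrictT _ _).1 => //;
      exact: measurable_funTS.
  - move=> x _; apply: cvg_near_cst; near=> n.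
    rewrite /fn patchE mem_set//= in_itv /= -ler_norml.
    by near: n; exact: nbhs_infty_ger.
  - by [].
  - exact: integrable_abse.
  - move=> n x _; rewrite /fn patchE; case: ifP => //= _.
    by rewrite normr0 lee_fin.
have cv0 : (\int[leb]_x fn n x @[n --> \oo] --> 0%:E)%E.
  rewrite -(cvg_shiftn 1).
  under eq_fun do rewrite addn1 FTC.
  apply: cvg_EFin; first exact: nearW.
  rewrite /comp /= -[0 : R]subr0; apply: cvgB.
  - by have := F1; rewrite -(cvg_shiftn 1); under eq_fun do rewrite addn1.
  - by have := F2; rewrite -(cvg_shiftn 1); under eq_fun do rewrite addn1.
by rewrite /Rintegral (cvg_unique _ cv cv0).
Unshelve. all: by end_near. Qed.

End DerivativeIntegral.

(** * One-dimensional Gaussian integrals with complex coefficient and complex centre *)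

Section ComplexGaussian.
Variable R : realType.
Local Notation leb := (@lebesgue_measure R).
Implicit Types (A w : R[i]) (x t : R).

Definition cgauss A w x : R[i] := cexp (- (A * (x%:C - w) ^+ 2)).

Lemma normc_cgauss A w x : normc (cgauss A w x) =
  expR (- (Re A * x ^+ 2) + 2 * (Re A * Re w - Im A * Im w) * x
        + (Re A * (Im w ^+ 2 - Re w ^+ 2) + 2 * Im A * Re w * Im w)).
Proof. by rewrite normc_cexp !ReImE; congr expR; ring. Qed.

(** [K] depends only on [a] and [M], so one real Gaussian dominates a whole box of parameters. Half
    of the decay [a] absorbs the linear term of the exponent and a further quarter absorbs the
    polynomial weight, which covers moments up to order 2. *)
Lemma ler_cgauss (a M : R) : 0 < a -> 0 <= M -> exists2 K : R, 0 <= K &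
  forall A w x, Re A = a -> `|Im A| <= M -> `|Re w| <= M -> `|Im w| <= M ->
  (1 + normc (x%:C - w) ^+ 2) * normc (cgauss A w x) <= K * expR (- (a / 4 * x ^+ 2)).
Proof.
move=> a0 M0.
(* The first summand is the cost of completing the square in the linear term, the second bounds the
   constant term. *)
pose K0 := 2 / a * (a * M + M * M) ^+ 2 + (a * M ^+ 2 + 2 * M * M * M).
have ia : 0 < a^-1 by rewrite invr_gt0.
exists ((1 + 3 * M ^+ 2 + 8 / a) * expR K0).
  rewrite mulr_ge0 ?expR_ge0// !addr_ge0// ?mulr_ge0 ?sqr_ge0//.
  exact: ltW.
move=> A w x rA iA rw iw.
have sq (y : R) : `|y| <= M -> y ^+ 2 <= M ^+ 2.
  by move=> yM; rewrite -(real_normK (num_real y)) ler_sqr ?nnegrE.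
have E1 : normc (cgauss A w x) <= expR (- (a / 2 * x ^+ 2)) * expR K0.
  rewrite -expRD normc_cgauss ler_expR rA.
  set P := a * Re w - Im A * Im w.
  have PM : P ^+ 2 <= (a * M + M * M) ^+ 2.
    rewrite -(real_normK (num_real P)) ler_sqr ?nnegrE ?addr_ge0 ?mulr_ge0 ?(ltW a0)//.
    rewrite (le_trans (ler_normB _ _))// !normrM (gtr0_norm a0) lerD//.
      by rewrite ler_pM2l.
    exact: ler_pM.
  have h1 : 2 * P * x <= a / 2 * x ^+ 2 + 2 / a * P ^+ 2.
    rewrite -subr_ge0.
    have -> : a / 2 * x ^+ 2 + 2 / a * P ^+ 2 - 2 * P * x = a / 2 * (x - 2 * P / a) ^+ 2.
      by field; rewrite gt_eqF.
    by rewrite mulr_ge0 ?sqr_ge0// divr_ge0// ltW.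
  have h2 : 2 / a * P ^+ 2 <= 2 / a * (a * M + M * M) ^+ 2.
    by rewrite ler_wpM2l// divr_ge0// ltW.
  have h3 : a * (Im w ^+ 2 - Re w ^+ 2) <= a * M ^+ 2.
    rewrite ler_wpM2l ?(ltW a0)// lerBlDr (le_trans (sq _ iw))// lerDl sqr_ge0//.
  have h4 : 2 * Im A * Re w * Im w <= 2 * M * M * M.
    rewrite (le_trans (ler_norm _))// !normrM (ger0_norm (_ : 0 <= 2))//.
    by rewrite !ler_pM// ?mulr_ge0.
  rewrite /K0; lra.
(* From [1 + y <= exp y] at [y = a x^2 / 4], where [8 / a * y = 2 x^2]. *)
have E2 : 1 + normc (x%:C - w) ^+ 2 <= (1 + 3 * M ^+ 2 + 8 / a) * expR (a / 4 * x ^+ 2).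
  rewrite normc_sqr !ReImE -!expr2.
  have h1 := expR_ge1Dx (a / 4 * x ^+ 2).
  have y0 : 0 <= a / 4 * x ^+ 2 by rewrite mulr_ge0 ?sqr_ge0// divr_ge0// ltW.
  have h3 : 1 + 3 * M ^+ 2 <= (1 + 3 * M ^+ 2) * expR (a / 4 * x ^+ 2).
    rewrite ler_peMr//; last lra.
    by rewrite addr_ge0// mulr_ge0// sqr_ge0.
  have h4 : 8 / a * (a / 4 * x ^+ 2) <= 8 / a * expR (a / 4 * x ^+ 2).
    rewrite ler_wpM2l//; last lra.
    by rewrite divr_ge0// ltW.
  have h5 : 8 / a * (a / 4 * x ^+ 2) = 2 * x ^+ 2 by field; rewrite gt_eqF.
  have h6 : (x - Re w) ^+ 2 <= 2 * x ^+ 2 + 2 * Re w ^+ 2.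
    by have := sqr_ge0 (x + Re w); rewrite -subr_ge0; lra.
  have := sq _ rw; have := sq _ iw.
  rewrite add0r sqrrN; lra.
apply: le_trans (ler_pM _ _ E2 E1) _; rewrite ?normc_ge0//.
  by rewrite addr_ge0// exprn_ge0// normc_ge0.
rewrite [expR (- (a / 2 * _)) * _]mulrC mulrACA -expRD ler_pM2l.
  by rewrite ler_expR; lra.
rewrite mulr_gt0 ?expR_gt0// ltr_pwDl ?divr_ge0 ?(ltW a0)//.
by rewrite ltr_pwDl// mulr_ge0 ?sqr_ge0.
Qed.

Lemma ler_polygauss (g : R -> R[i]) (k : R) A w : 0 < Re A -> 0 <= k ->
  (forall x, normc (g x) <= k * (1 + normc (x%:C - w) ^+ 2)) ->
  exists K : R, forall x,
    normc (g x * cgauss A w x) <= K * expR (- (Re A / 4 * x ^+ 2)).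
Proof.
move=> A0 k0 gk.
pose M := Num.max `|Im A| (Num.max `|Re w| `|Im w|).
have M0 : 0 <= M by rewrite !le_max normr_ge0.
have [K K0 HK] := ler_cgauss A0 M0.
exists (k * K) => x.
rewrite Normc.normcM (le_trans (ler_wpM2r (normc_ge0 _) (gk x)))// -[leLHS]mulrA -[leRHS]mulrA ler_wpM2l//.
by apply: HK; rewrite // !le_max lexx ?orbT.
Qed.

Lemma is_cderive_measurable (f df : R -> R[i]) : (forall x, is_cderive x f (df x)) ->
  measurable_fun setT (Re \o f) /\ measurable_fun setT (Im \o f).
Proof.
by move=> /is_cderive_continuous[c1 c2]; split; apply: continuous_measurable_fun.
Qed.

Lemma is_cderive_shift x w : is_cderive x (fun x => x%:C - w) 1.
Proof.
apply: (is_cderive_eq (is_cderiveD (is_cderive_real x) (is_cderive_cst x (- w)))).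
by rewrite addr0.
Qed.

Lemma is_cderive_cgauss A w x :
  is_cderive x (cgauss A w) (- (2 * A * (x%:C - w)) * cgauss A w x).
Proof.
have d := is_cderive_shift x w.
have /is_cderive_cexp := is_cderiveN (is_cderiveM (is_cderive_cst x A) (is_cderiveM d d)).
by move=> /is_cderive_eq; apply; rewrite /cgauss /cst /=; congr (_ * _); ring.
Qed.

Lemma cintegrable_polygauss (g dg : R -> R[i]) (k : R) A w : 0 < Re A -> 0 <= k ->
  (forall x, is_cderive x g (dg x)) ->
  (forall x, normc (g x) <= k * (1 + normc (x%:C - w) ^+ 2)) ->
  cintegrable leb (fun x => g x * cgauss A w x).
Proof.
move=> A0 k0 dg' gk; have [K HK] := ler_polygauss A0 k0 gk.
have [m1 m2] := is_cderive_measurable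
  (fun x => is_cderiveM (dg' x) (is_cderive_cgauss A w x)).
apply: (@le_cintegrable _ _ _ leb _ (fun x => K * expR (- (Re A / 4 * x ^+ 2)))) => //.
by apply: integrable_gauss; rewrite divr_gt0.
Qed.

(** Gaussian decay of the primitive [F] removes the boundary terms; [df] provides the continuity of
    [f] required by the fundamental theorem. *)
Lemma cint_derive_eq0 (F f df : R -> R[i]) (K e : R) : 0 < e ->
  (forall x, is_cderive x F (f x)) -> (forall x, is_cderive x f (df x)) ->
  cintegrable leb f ->
  (forall x, normc (F x) <= K * expR (- (e * x ^+ 2))) ->
  cint leb f = 0.
Proof.
move=> e0 dF /is_cderive_continuous[c1 c2] [i1 i2] FK.
(* The sign [s] is 1 or -1, one for each end of the line. *)
have cv (p : R[i] -> R) (s : R) : s ^+ 2 = 1 -> (forall z, `|p z| <= normc z) ->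
    p (F (s * n%:R)) @[n --> \oo] --> (0 : R).
  move=> s2 pn; apply: norm_cvg0.
  apply: (@squeeze_cvgr _ _ _ _ (cst 0) (fun n : nat => K * expR (- (e * n%:R ^+ 2)))).
  - apply: nearW => n; rewrite normr_ge0 /= (le_trans (pn _))// (le_trans (FK _))//.
    by rewrite exprMn s2 mul1r.
  - exact: cvg_cst.
  - exact: cvg_gauss.
have s1 : (1 : R) ^+ 2 = 1 by rewrite expr1n.
have s2 : (-1 : R) ^+ 2 = 1 by rewrite sqrrN expr1n.
apply: complex_eq; rewrite /cint /=.
  apply: (@Rintegral_derive_eq0 R (Re \o F)) => //.
  - by move=> x; have [] := dF x.
  - by have := cv _ _ s1 (@ler_normc_Re R); under eq_fun do rewrite mul1r.
  - by have := cv _ _ s2 (@ler_normc_Re R); under eq_fun do rewrite mulN1r.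
apply: (@Rintegral_derive_eq0 R (Im \o F)) => //.
- by move=> x; have [] := dF x.
- by have := cv _ _ s1 (@ler_normc_Im R); under eq_fun do rewrite mul1r.
- by have := cv _ _ s2 (@ler_normc_Im R); under eq_fun do rewrite mulN1r.
Qed.

Let ler_shift1 (z : R[i]) : normc z <= 1 + normc z ^+ 2.
Proof. by have := sqr_ge0 (normc z - 1); have := normc_ge0 z; nra. Qed.

Lemma cintegrable_cgauss A w : 0 < Re A -> cintegrable leb (cgauss A w).
Proof.
move=> A0; have := @cintegrable_polygauss (cst 1) (cst 0) 1 A w A0 ler01
  (fun x => is_cderive_cst x 1).
under [X in cintegrable _ X]eq_fun do rewrite mul1r.
apply => x; by rewrite /cst normc1 mul1r lerDl exprn_ge0// normc_ge0.
Qed.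

Let cintegrable1 A w : 0 < Re A -> cintegrable leb (fun x => (x%:C - w) * cgauss A w x).
Proof.
move=> A0; apply: (@cintegrable_polygauss _ (cst 1) 1 A w A0 ler01).
  by move=> x; exact: is_cderive_shift.
by move=> x; rewrite mul1r.
Qed.

Let cintegrable2 A w : 0 < Re A ->
  cintegrable leb (fun x => (x%:C - w) ^+ 2 * cgauss A w x).
Proof.
move=> A0; apply: (@cintegrable_polygauss _ _ 1 A w A0 ler01).
  by move=> x; have d := is_cderive_shift x w; exact: (is_cderiveM d d).
by move=> x; rewrite mul1r expr2 Normc.normcM -expr2 lerDr.
Qed.

Lemma Re_gt0_neq0 A : 0 < Re A -> A != 0.
Proof. by apply: contraTneq => ->; rewrite Re0 ltxx. Qed.

(** Multiplied by [- 2 A], the integrand is the derivative of the Gaussian itself. *)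
Lemma cgauss_moment1 A w : 0 < Re A ->
  cint leb (fun x => (x%:C - w) * cgauss A w x) = 0.
Proof.
move=> A0; have nA := Re_gt0_neq0 A0.
have [|K HK] := @ler_polygauss (cst 1) 1 A w A0 ler01.
  by move=> x; rewrite /cst normc1 mul1r lerDl exprn_ge0// normc_ge0.
have : cint leb (fun x => (- (2 * A)) * ((x%:C - w) * cgauss A w x)) = 0.
  have e0 : 0 < Re A / 4 by rewrite divr_gt0.
  apply: (@cint_derive_eq0 (cgauss A w) _
    (fun x => 0 * ((x%:C - w) * cgauss A w x) + - (2 * A) *
      (1 * cgauss A w x + (x%:C - w) * (- (2 * A * (x%:C - w)) * cgauss A w x))) K _ e0).
  - by move=> x; apply: (is_cderive_eq (is_cderive_cgauss A w x)); ring.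
  - move=> x; apply: (is_cderiveM (is_cderive_cst x _)).
    exact: (is_cderiveM (is_cderive_shift x w) (is_cderive_cgauss A w x)).
  - exact/cintegrableZl/cintegrable1.
  - by move=> x; have := HK x; rewrite mul1r.
rewrite cintZl; last exact: cintegrable1.
move/eqP; rewrite mulf_eq0 oppr_eq0 mulf_eq0 (negbTE nA) pnatr_eq0 /=.
by move/eqP.
Qed.

(** Integration by parts: the derivative of [(x - w) * cgauss A w x] is the Gaussian minus
    [2 A (x - w)^2] times the Gaussian, and it integrates to 0. *)
Lemma cgauss_moment2 A w : 0 < Re A ->
  2 * A * cint leb (fun x => (x%:C - w) ^+ 2 * cgauss A w x) = cint leb (cgauss A w).
Proof.
move=> A0.
have [|K HK] := @ler_polygauss (fun x => x%:C - w) 1 A w A0 ler01.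
  by move=> x; rewrite mul1r.
have e0 : 0 < Re A / 4 by rewrite divr_gt0.
have : cint leb (fun x => cgauss A w x + (- (2 * A)) * ((x%:C - w) ^+ 2 * cgauss A w x)) = 0.
  have D x : is_cderive x (fun x => (x%:C - w) * cgauss A w x)
      (cgauss A w x + (- (2 * A)) * ((x%:C - w) ^+ 2 * cgauss A w x)).
    apply: (is_cderive_eq (is_cderiveM (is_cderive_shift x w) (is_cderive_cgauss A w x))).
    by ring.
  apply: (@cint_derive_eq0 _ _ (fun x => - (2 * A * (x%:C - w)) * cgauss A w x +
     (0 * ((x%:C - w) ^+ 2 * cgauss A w x) + (- (2 * A)) *
      ((1 * (x%:C - w) + (x%:C - w) * 1) * cgauss A w x +
        (x%:C - w) ^+ 2 * (- (2 * A * (x%:C - w)) * cgauss A w x)))) K _ e0 D).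
  - move=> x; have d := is_cderive_shift x w.
    apply: is_cderiveD; first exact: is_cderive_cgauss.
    apply: (is_cderiveM (is_cderive_cst x _)).
    exact: (is_cderiveM (is_cderiveM d d) (is_cderive_cgauss A w x)).
  - apply: cintegrableD; first exact: cintegrable_cgauss.
    exact/cintegrableZl/cintegrable2.
  - exact: HK.
rewrite cintD ?cintZl; [|exact: cintegrable2|exact: cintegrable_cgauss|].
  by move/eqP; rewrite mulNr subr_eq0 => /eqP.
exact/cintegrableZl/cintegrable2.
Qed.

(* Along A(t) = A0 + i t b, w(t) = t w1 the real part of A stays fixed, so a
   single Gaussian dominates the integrand locally uniformly in t. *)
Lemma is_cderive_cint_cgauss A0 (b : R) w1 t : 0 < Re A0 ->
  let A s := A0 + s%:C * (0 +i* b) in let w s := s%:C * w1 in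
  is_cderive t (fun s => cint leb (cgauss (A s) (w s)))
    (- ((0 +i* b) * cint leb (fun x => (x%:C - w t) ^+ 2 * cgauss (A t) (w t) x))).
Proof.
move=> rA0 A w; set B : R[i] := 0 +i* b.
have rA s : Re (A s) = Re A0.
  by rewrite /A /B !ReImE /=; ring.
have rA' s : 0 < Re (A s) by rewrite rA.
(* The two summands come from the motion of [A] and from that of [w]. *)
pose f' s x := - B * ((x%:C - w s) ^+ 2 * cgauss (A s) (w s) x) +
  (2 * A s * w1) * ((x%:C - w s) * cgauss (A s) (w s) x).
pose N := normc A0 + normc B + normc w1.
have N0 : 0 <= N by rewrite !addr_ge0// normc_ge0.
(* Bounds the moduli of [A s] and [w s] for [s] within 1 of [t]; [k] below then bounds the
   polynomial factor of [f'] against [1 + |x - w s|^2]. *)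
pose M := (`|t| + 2) * N.
have M0 : 0 <= M by rewrite mulr_ge0// addr_ge0.
have [K K0 HK] := ler_cgauss rA0 M0.
have e0 : 0 < Re A0 / 4 by rewrite divr_gt0.
pose k := N + 2 * M * N.
have k0 : 0 <= k by rewrite addr_ge0// !mulr_ge0.
have tt : t - 1 < t < t + 1 by rewrite ltrBlDr ltrDl ltr01.
have key := @is_cderive_cint _ _ _ leb (fun s => cgauss (A s) (w s)) f' t (t - 1) (t + 1)
  (fun x => k * K * expR (- (Re A0 / 4 * x ^+ 2))) tt _ _ (integrable_gauss _ e0) _.
have {}key : is_cderive t (fun s => cint leb (cgauss (A s) (w s))) (cint leb (f' t)).
  apply: key.
  - by move=> s; exact: cintegrable_cgauss.
  - move=> s x.
    have dA : is_cderive s A B.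
      apply: (is_cderive_eq (is_cderiveD (is_cderive_cst s A0)
        (is_cderiveM (is_cderive_real s) (is_cderive_cst s B)))).
      by rewrite /cst; ring.
    have dw : is_cderive s (fun s => x%:C - w s) (- w1).
      apply: (is_cderive_eq (is_cderiveD (is_cderive_cst s x%:C) (is_cderiveN
        (is_cderiveM (is_cderive_real s) (is_cderive_cst s w1))))).
      by rewrite /cst; ring.
    apply: (is_cderive_eq (is_cderive_cexp (is_cderiveN (is_cderiveM dA
      (is_cderiveM dw dw))))).
    by rewrite /f' /cgauss /=; ring.
  - move=> s x /andP[s1 s2].
    have st : `|s| <= `|t| + 1.
      have : `|s - t| <= 1 by rewrite ler_norml; lra.
      by have := ler_normD (s - t) t; rewrite subrK; lra.
    have n0 := normc_ge0 A0; have n1 := normc_ge0 B; have n2 := normc_ge0 w1.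
    have t0 := normr_ge0 t; have s0 := normr_ge0 s.
    have nA : normc (A s) <= M.
      rewrite (le_trans (le_normcD _ _))// Normc.normcM normc_real /M /N.
      have : `|s| * normc B <= (`|t| + 1) * normc B by rewrite ler_wpM2r.
      nra.
    have nw : normc (w s) <= M.
      rewrite Normc.normcM normc_real /M /N.
      have : `|s| * normc w1 <= (`|t| + 1) * normc w1 by rewrite ler_wpM2r.
      nra.
    have nG := HK (A s) (w s) x (rA s) (le_trans (ler_normc_Im _) nA)
       (le_trans (ler_normc_Re _) nw) (le_trans (ler_normc_Im _) nw).
    rewrite -mulrA; apply: le_trans (ler_wpM2l k0 nG).
    rewrite /f' !mulrA -mulrDl Normc.normcM ler_wpM2r ?normc_ge0//.
    rewrite (le_trans (le_normcD _ _))// expr2 !Normc.normcM normcN -expr2.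
    set q := normc (x%:C - w s).
    have q0 : 0 <= q by exact: normc_ge0.
    have q1 : q <= 1 + q ^+ 2 by exact: ler_shift1.
    have -> : normc (2 : R[i]) = 2.
      by have := normc_real (2 : R); rewrite rmorph_nat ger0_norm.
    have h1 : normc B * q ^+ 2 <= N * (1 + q ^+ 2).
      by rewrite ler_pM ?sqr_ge0// /N; lra.
    have h2 : 2 * normc (A s) * normc w1 * q <= 2 * M * N * (1 + q ^+ 2).
      have nA0 := normc_ge0 (A s).
      rewrite ler_pM ?mulr_ge0// ler_pM ?mulr_ge0// ?ler_wpM2l//.
      by rewrite /N; lra.
    rewrite /k; lra.
apply: (is_cderive_eq key); rewrite /f' cintD; last 2 first.
- exact/cintegrableZl/cintegrable2.
- exact/cintegrableZl/cintegrable1.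
rewrite !cintZl; do ?[exact: cintegrable1|exact: cintegrable2].
(* The motion of [w] contributes only a first moment, which vanishes. *)
by rewrite cgauss_moment1// mulr0 addr0 mulNr.
Qed.

(** The path with [b = 0] fixes [A] and moves the centre from 0 to [w]; the derivative formula then
    gives 0. This stands in for a shift of contour. *)
Lemma cint_cgauss_shift A w : 0 < Re A -> cint leb (cgauss A w) = cint leb (cgauss A 0).
Proof.
move=> A0.
have D t : is_cderive t (fun s => cint leb (cgauss A (s%:C * w))) 0.
  have := @is_cderive_cint_cgauss A 0 w t A0.
  have -> : 0 +i* 0 = 0 :> R[i] by [].
  under eq_fun do rewrite mulr0 addr0.
  by move=> /= /is_cderive_eq; apply; rewrite mul0r oppr0.
have := is_cderive0_cst D 1 0.
by rewrite mul1r mul0r.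
Qed.

(** Squaring avoids choosing a branch of the square root of [A]. The path runs from the real number
    [Re A], where the value is classical, to [A]. *)
Lemma cint_cgauss_sqr A : 0 < Re A -> cint leb (cgauss A 0) ^+ 2 * A = pi%:C.
Proof.
move=> A0; pose B : R[i] := 0 +i* Im A.
pose a : R[i] := (Re A)%:C.
have rAs s : 0 < Re (a + s%:C * B) by rewrite /a /B !ReImE /=; lra.
have D t : is_cderive t (fun s => cint leb (cgauss (a + s%:C * B) 0) *
    cint leb (cgauss (a + s%:C * B) 0) * (a + s%:C * B)) 0.
  have dJ := @is_cderive_cint_cgauss a (Im A) 0 t A0.
  move: dJ => /=; under eq_fun do rewrite mulr0.
  rewrite mulr0 -/B => dJ.
  have dA : is_cderive t (fun s => a + s%:C * B) B.
    apply: (is_cderive_eq (is_cderiveD (is_cderive_cst t a)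
      (is_cderiveM (is_cderive_real t) (is_cderive_cst t B)))).
    by rewrite /cst; ring.
  apply: (is_cderive_eq (is_cderiveM (is_cderiveM dJ dJ) dA)).
  (* With [m] the second moment and [A] the current coefficient, [J = 2 A m] and [J' = - B m], so
     [2 J J' A + J^2 B] cancels. *)
  rewrite -(@cgauss_moment2 (a + t%:C * B) 0)//.
  by ring.
have := is_cderive0_cst D 1 0.
rewrite mul1r mul0r addr0.
have -> : a + B = A by apply: complex_eq; rewrite /a /B !ReImE /=; ring.
rewrite -expr2 => ->.
have -> : cint leb (cgauss a 0) = (Num.sqrt (pi / Re A))%:C.
  rewrite (_ : cgauss a 0 = fun x => (expR (- (Re A * x ^+ 2)))%:C); last first.
    apply/funext => x; rewrite -cexp_real; congr cexp.
    by apply: complex_eq; rewrite /a !ReImE; ring.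
  apply: complex_eq; rewrite /cint /=.
    by rewrite /Rintegral /= integral_gauss.
  by rewrite Rintegral_cst//= mul0r.
rewrite -!rmorphM /= -expr2 sqr_sqrtr ?divr_ge0 ?pi_ge0 ?(ltW A0)//.
by rewrite divfK// gt_eqF.
Qed.

End ComplexGaussian.

(** * Measurability of complex-valued functions *)

Section ComplexMeasurable.
Context d (T : measurableType d) (R : realType).
Implicit Types f g : T -> R[i].

Definition cmeasurable f : Prop :=
  measurable_fun setT (Re \o f) /\ measurable_fun setT (Im \o f).

Lemma cmeasurable_cst k : cmeasurable (cst k).
Proof. by split; exact: measurable_cst. Qed.

Lemma cmeasurable_real (u : T -> R) : measurable_fun setT u ->
  cmeasurable (fun x => (u x)%:C).
Proof. by move=> mu; split=> //; exact: measurable_cst. Qed.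

Lemma cmeasurableD f g : cmeasurable f -> cmeasurable g ->
  cmeasurable (fun x => f x + g x).
Proof.
move=> [f1 f2] [g1 g2]; split; rewrite /comp.
  by under eq_fun do rewrite ReD; exact: measurable_funD.
by under eq_fun do rewrite ImD; exact: measurable_funD.
Qed.

Lemma cmeasurableN f : cmeasurable f -> cmeasurable (fun x => - f x).
Proof.
move=> [f1 f2]; split; rewrite /comp.
  by under eq_fun do rewrite ReN; exact: measurableT_comp.
by under eq_fun do rewrite ImN; exact: measurableT_comp.
Qed.

Lemma cmeasurableM f g : cmeasurable f -> cmeasurable g ->
  cmeasurable (fun x => f x * g x).
Proof.
move=> [f1 f2] [g1 g2]; split; rewrite /comp.
  by under eq_fun do rewrite ReM; apply: measurable_funB; exact: measurable_funM.
by under eq_fun do rewrite ImM; apply: measurable_funD; exact: measurable_funM.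
Qed.

Lemma cmeasurable_cexp f : cmeasurable f -> cmeasurable (fun x => cexp (f x)).
Proof.
move=> [f1 f2]; split; apply: measurable_funM.
- exact: (measurableT_comp (@measurable_expR R)).
- apply: (measurableT_comp _ f2); apply: continuous_measurable_fun.
  exact: continuous_cos.
- exact: (measurableT_comp (@measurable_expR R)).
- apply: (measurableT_comp _ f2); apply: continuous_measurable_fun.
  exact: continuous_sin.
Qed.

End ComplexMeasurable.

(** * Gaussian integrals over the plane with a complex quadratic form *)

Section PlaneGaussian.
Variable R : realType.
Local Notation leb := (@lebesgue_measure R).

(** Integrability is asked of every slice, not of almost every one, so that [fine] can be taken
    inside the outer integral pointwise. *)
Lemma Rintegral_fubini (f : R * R -> R) :
  (leb \x leb)%E.-integrable setT (EFin \o f) ->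
  (forall y, leb.-integrable setT (EFin \o (fun x => f (x, y)))) ->
  Rintegral (leb \x leb)%E setT f =
  Rintegral leb setT (fun y => Rintegral leb setT (fun x => f (x, y))).
Proof.
move=> intf inty; rewrite {1}/Rintegral -integral21_prod_meas1//.
congr fine; apply: eq_integral => y _; rewrite /fubini_G /Rintegral fineK//.
by apply: integrable_fin_num; [|exact: inty].
Qed.

Lemma cint_fubini (f : R * R -> R[i]) :
  cintegrable (leb \x leb)%E f -> (forall y, cintegrable leb (fun x => f (x, y))) ->
  cint (leb \x leb)%E f = cint leb (fun y => cint leb (fun x => f (x, y))).
Proof.
move=> [f1 f2] intf; rewrite /cint /comp /= !Rintegral_fubini//.
- by move=> y; have [] := intf y.
- by move=> y; have [] := intf y.
Qed.

Lemma integrable_gauss2 (K e : R) : 0 < e -> 0 <= K ->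
  (leb \x leb)%E.-integrable setT
    (EFin \o (fun q : R * R => K * expR (- (e * q.1 ^+ 2)) * expR (- (e * q.2 ^+ 2)))).
Proof.
move=> e0 K0.
have mg (h : R * R -> R) : measurable_fun setT h ->
    measurable_fun setT (fun q => expR (- (e * h q ^+ 2))).
  move=> mh; apply: (measurableT_comp (@measurable_expR R)).
  apply: measurableT_comp => //; apply: measurable_funM => //.
  exact: measurable_funX.
apply/integrable12ltyP.
  apply/measurable_EFinP; apply: measurable_funM.
    by apply: measurable_funM => //; apply: (mg fst); exact: measurable_fst.
  by apply: (mg snd); exact: measurable_snd.
pose g x := ((Num.sqrt (pi / e))%:E * (K * expR (- (e * x ^+ 2)))%:E)%E.
have inner x : (\int[leb]_y `|(EFin \o (fun q : R * R =>
    (K * expR (- (e * q.1 ^+ 2)) * expR (- (e * q.2 ^+ 2)))%R)) (x, y)| = g x)%E.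
  rewrite /g muleC -(integral_gauss e0) -integralZl//; last first.
    by have := integrable_gauss 1 e0; rewrite /comp; under eq_fun do rewrite mul1r.
  apply: eq_integral => y _ /=; rewrite -EFinM ger0_norm//.
  by rewrite !mulr_ge0// expR_ge0.
under eq_integral do rewrite inner.
have ig := integrable_gauss K e0.
have := integrable_fin_num measurableT ig.
by rewrite integralZl// => /fineK <-; rewrite -EFinM ltry.
Qed.

Variables A C D x0 y0 : R[i].
Variable e : R.
Hypothesis e0 : 0 < e.
Hypothesis pos_form : forall x y : R,
  e * (x ^+ 2 + y ^+ 2) <= Re A * x ^+ 2 + 2 * Re C * x * y + Re D * y ^+ 2.

(** The Gaussian of the symmetric matrix with rows [(A, C)] and [(C, D)], centred at a complex
    point. *)
Definition cgauss2 (q : R * R) : R[i] :=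
  cexp (- (A * (q.1%:C - x0) ^+ 2 + 2 * C * (q.1%:C - x0) * (q.2%:C - y0)
           + D * (q.2%:C - y0) ^+ 2)).

Let Apos : 0 < Re A.
Proof.
by have := pos_form 1 0; rewrite expr1n expr0n /= !(mulr1, mulr0, addr0); exact: lt_le_trans.
Qed.

(* The Hermitian form of the real part, evaluated at the complex vector (-C/A, 1). *)
Let schur_pos : 0 < Re (D - C ^+ 2 / A).
Proof.
have nA := Re_gt0_neq0 Apos.
pose X := - (C / A).
have -> : D - C ^+ 2 / A = conjc X * (A * X + C) + (C * X + D).
  have -> : A * X + C = 0 by rewrite /X; field.
  by rewrite mulr0 add0r /X; field.
(* The real part of the Hermitian form splits into [pos_form] at the real vectors [(Re X, 1)] and
   [(Im X, 0)]. *)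
move: X => X; have h1 := pos_form (Re X) 1; have h2 := pos_form (Im X) 0.
have h3 : 0 < e * (Re X ^+ 2 + 1 ^+ 2) + e * (Im X ^+ 2 + 0 ^+ 2).
  rewrite ltr_pwDl ?mulr_gt0//; last by rewrite mulr_ge0 ?(ltW e0)// addr_ge0// sqr_ge0.
  by rewrite expr1n ltr_pwDr// sqr_ge0.
by rewrite !ReImE; move: h1 h2 h3; rewrite ?expr2; lra.
Qed.

(** The complex centre adds linear terms [l1 x + l2 y] to the real exponent; half of [e] absorbs
    them and the rest is a product of two real Gaussians. *)
Lemma cintegrable_cgauss2 : cintegrable (leb \x leb)%E cgauss2.
Proof.
pose l1 := Re (2 * (A * x0 + C * y0)); pose l2 := Re (2 * (C * x0 + D * y0)).
pose k := - Re (A * x0 ^+ 2 + 2 * C * x0 * y0 + D * y0 ^+ 2).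
pose K := expR (k + l1 ^+ 2 / (2 * e) + l2 ^+ 2 / (2 * e)).
have [m1 m2] : cmeasurable cgauss2.
  have q1 : cmeasurable (fun q : R * R => q.1%:C - x0).
    apply: cmeasurableD; last exact: cmeasurable_cst.
    by apply: (@cmeasurable_real _ _ _ fst); exact: measurable_fst.
  have q2 : cmeasurable (fun q : R * R => q.2%:C - y0).
    apply: cmeasurableD; last exact: cmeasurable_cst.
    by apply: (@cmeasurable_real _ _ _ snd); exact: measurable_snd.
  apply/cmeasurable_cexp/cmeasurableN; apply: cmeasurableD; first apply: cmeasurableD.
  - exact: (cmeasurableM (cmeasurable_cst _ _) (cmeasurableM q1 q1)).
  - by apply: (cmeasurableM _ q2); apply: (cmeasurableM _ q1); exact: cmeasurable_cst.
  - exact: (cmeasurableM (cmeasurable_cst _ _) (cmeasurableM q2 q2)).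
apply: (@le_cintegrable _ _ _ (leb \x leb)%E cgauss2 (fun q : R * R =>
  K * expR (- (e / 2 * q.1 ^+ 2)) * expR (- (e / 2 * q.2 ^+ 2)))) => //.
  by apply: integrable_gauss2; [rewrite divr_gt0|rewrite expR_ge0].
move=> [x y]; rewrite /K -!expRD /cgauss2 normc_cexp ler_expR -[(x, y).1]/x -[(x, y).2]/y.
have -> : Re (- (A * (x%:C - x0) ^+ 2 + 2 * C * (x%:C - x0) * (y%:C - y0) +
       D * (y%:C - y0) ^+ 2)) =
   - (Re A * x ^+ 2 + 2 * Re C * x * y + Re D * y ^+ 2) + l1 * x + l2 * y + k.
  by rewrite /l1 /l2 /k !ReImE; ring.
have h := pos_form x y.
have sq (l u : R) : l * u <= e / 2 * u ^+ 2 + l ^+ 2 / (2 * e).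
  rewrite -subr_ge0.
  have -> : e / 2 * u ^+ 2 + l ^+ 2 / (2 * e) - l * u = (e * u - l) ^+ 2 / (2 * e).
    by field; rewrite gt_eqF.
  by rewrite divr_ge0 ?sqr_ge0// mulr_ge0// ltW.
have := sq l1 x; have := sq l2 y; lra.
Qed.

(** Completing the square in [x] gives coefficient [A] with a centre [w y] depending on [y], and
    leaves the Schur complement [S] in [y]. By shift invariance the inner integral does not see
    [w y], and [A * S] is the determinant. *)
Lemma cint_cgauss2 : cint (leb \x leb)%E cgauss2 ^+ 2 * (A * D - C ^+ 2) = pi%:C ^+ 2.
Proof.
have nA := Re_gt0_neq0 Apos.
pose S := D - C ^+ 2 / A; pose w (y : R) := x0 - C / A * (y%:C - y0).
have FE (x y : R) : cgauss2 (x, y) = cgauss S y0 y * cgauss A (w y) x.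
  by rewrite -cexpD; congr cexp; rewrite /S /w /=; field.
have inner y : (fun x => cgauss2 (x, y)) = (fun x => cgauss S y0 y * cgauss A (w y) x).
  by apply/funext => x; exact: FE.
rewrite cint_fubini; last 2 first.
- exact: cintegrable_cgauss2.
- by move=> y; rewrite inner; exact/cintegrableZl/cintegrable_cgauss.
rewrite (_ : (fun y => _) = (fun y => cint leb (cgauss A 0) * cgauss S y0 y)); last first.
  apply/funext => y; rewrite inner cintZl ?cint_cgauss_shift// 1?mulrC//.
  exact: cintegrable_cgauss.
rewrite cintZl; last exact: cintegrable_cgauss.
rewrite (cint_cgauss_shift y0 (schur_pos : 0 < Re S)).
have := cint_cgauss_sqr (schur_pos : 0 < Re S); have := cint_cgauss_sqr Apos.
move: (cint leb (cgauss A 0)) (cint leb (cgauss S 0)) => k1 k2 h1 h2.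
have -> : (k1 * k2) ^+ 2 * (A * D - C ^+ 2) = k1 ^+ 2 * A * (k2 ^+ 2 * S).
  by rewrite /S; field.
by rewrite h1 h2 expr2.
Qed.

End PlaneGaussian.

(** Expansion of the phase at its critical point, where [Z = z + (u + I v)] and
    [Z' = zeta + (u - I v)]. Eliminating [a] and [b] by the critical equations cancels the linear
    terms. Here [b] and [delta] play the conjugates of the parameters of the second function. *)
Lemma gauss_phaseE (K : numFieldType) (I al a b c delta z zeta x y : K) :
  I ^+ 2 = -1 -> zeta = a + c * z ->
  z = b + delta * zeta ->
  let h := 2^-1 in let Z := x + I * y in let Z' := x - I * y in
  let u := x - h * (z + zeta) in let v := y + h * I * (z - zeta) in
  al * a * Z + al * h * c * Z ^+ 2 + (al * b * Z' + al * h * delta * Z' ^+ 2)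
    - al * (x ^+ 2 + y ^+ 2) =
  al * h * (a * z + b * zeta) -
  (al * (1 - h * (c + delta)) * u ^+ 2
   + 2 * (- (al * h * I * (c - delta))) * u * v
   + al * (1 + h * (c + delta)) * v ^+ 2).
Proof.
move=> i2 Ezeta Ez h Z Z' u v.
have Ea : a = zeta - c * z by rewrite Ezeta addrK.
have Eb : b = z - delta * zeta by rewrite {1}Ez addrK.
have EZ : Z = z + (u + I * v).
  by rewrite /Z /u /v /h; field: i2.
have EZ' : Z' = zeta + (u - I * v).
  by rewrite /Z' /u /v /h; field: i2.
have EXY : x ^+ 2 + y ^+ 2 = Z * Z' by rewrite /Z /Z'; ring: i2.
rewrite EXY EZ EZ' Ea Eb; move: u v {EXY EZ EZ' Z Z'} => u v.
by rewrite /h; field: i2.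
Qed.

(** * Pairings and norms of members of [Galpha], and comparison of critical values *)

Section GaussianPairings.
Variable R : realType.
Implicit Types (a b c d z zeta : R[i]) (alpha : R).
Local Notation leb := (@lebesgue_measure R).

(** The left side is [Re (c (x + i y)^2)]. *)
Lemma Re_mul_sqr_le c (x y : R) :
  Re c * (x ^+ 2 - y ^+ 2) - 2 * Im c * x * y <= normc c * (x ^+ 2 + y ^+ 2).
Proof.
have -> : x ^+ 2 + y ^+ 2 = normc ((x +i* y) ^+ 2).
  by rewrite [(x +i* y) ^+ 2]expr2 Normc.normcM -expr2 normc_sqr.
rewrite -Normc.normcM; apply: le_trans (ler_norm _) _.
apply: le_trans (ler_normc_Re _); rewrite le_eqVlt; apply/orP; left; apply/eqP.
by congr `|_|; rewrite !ReImE /=; ring.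
Qed.

Lemma one_sub_neq0 c d : normc c < 1 -> normc d < 1 -> 1 - c * d != 0.
Proof.
move=> c1 d1; rewrite subr_eq0; apply: contraTneq (mulr_ilt1 (normc_ge0 c) (normc_ge0 d) c1 d1).
by rewrite -Normc.normcM => <-; rewrite normc1 ltxx.
Qed.

Lemma powR_expR (x s : R) : expR x `^ s = expR (s * x).
Proof. by rewrite /powR gt_eqF ?expR_gt0// expRK. Qed.

Lemma mulcJ c : c * conjc c = (normc c ^+ 2)%:C.
Proof. by rewrite normc_sqr; apply: complex_eq; rewrite !ReImE; ring. Qed.

Lemma normc_one_sub_mulcJ c : normc c < 1 -> normc (1 - c * conjc c) = 1 - normc c ^+ 2.
Proof.
move=> c1; rewrite mulcJ (_ : 1 - _ = (1 - normc c ^+ 2)%:C) ?normc_real ?ger0_norm//.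
  by rewrite subr_ge0 expr_le1 ?normc_ge0// ltW.
by apply: complex_eq; rewrite !ReImE; ring.
Qed.

(* (z, zeta) is the critical point of the holomorphic phase in which conj z has
   been replaced by an independent variable zeta. *)
Lemma ipr_gfun_sqr alpha a b c d z zeta : 0 < alpha ->
  normc c < 1 -> normc d < 1 ->
  zeta = a + c * z -> z = conjc b + conjc d * zeta ->
  ipr alpha (gfun alpha a c) (gfun alpha b d) ^+ 2 * (1 - c * conjc d) =
  cexp (alpha%:C * (a * z + conjc b * zeta)).
Proof.
move=> al0 c1 d1 Ezeta Ez.
pose delta := conjc d; pose b' := conjc b.
have halfE : (2^-1)%:C = 2^-1 :> R[i] by rewrite fmorphV rmorph_nat.
pose h : R[i] := 2^-1.
(* Coefficients and centre as produced by [gauss_phaseE]; the centre is characterised by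
   [x0 + i y0 = z] and [x0 - i y0 = zeta]. *)
pose A : R[i] := alpha%:C * (1 - h * (c + delta)).
pose D : R[i] := alpha%:C * (1 + h * (c + delta)).
pose C : R[i] := - (alpha%:C * h * 'i%C * (c - delta)).
pose x0 : R[i] := h * (z + zeta).
pose y0 : R[i] := - (h * 'i%C * (z - zeta)).
pose E0 : R[i] := alpha%:C * h * (a * z + b' * zeta).
(* With [w = x + i y], the real part of the form is [alpha (|w|^2 - Re (c w^2 + d w^2) / 2)], hence
   at least [alpha (1 - r) |w|^2]. *)
pose r := Num.max (normc c) (normc d).
have r1 : r < 1 by rewrite gt_max c1 d1.
pose e := alpha * (1 - r).
have e0 : 0 < e by rewrite mulr_gt0// subr_gt0.
have pos_form (x y : R) :
    e * (x ^+ 2 + y ^+ 2) <= Re A * x ^+ 2 + 2 * Re C * x * y + Re D * y ^+ 2.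
  have xy0 : 0 <= x ^+ 2 + y ^+ 2 by rewrite addr_ge0// sqr_ge0.
  have hc := Re_mul_sqr_le c x y; have hd := Re_mul_sqr_le d x y.
  have hc' : normc c * (x ^+ 2 + y ^+ 2) <= r * (x ^+ 2 + y ^+ 2).
    by rewrite ler_wpM2r// le_max lexx.
  have hd' : normc d * (x ^+ 2 + y ^+ 2) <= r * (x ^+ 2 + y ^+ 2).
    by rewrite ler_wpM2r// le_max lexx orbT.
  have -> : Re A * x ^+ 2 + 2 * Re C * x * y + Re D * y ^+ 2 =
    alpha * ((x ^+ 2 + y ^+ 2) - 2^-1 * ((Re c * (x ^+ 2 - y ^+ 2) - 2 * Im c * x * y) +
       (Re d * (x ^+ 2 - y ^+ 2) - 2 * Im d * x * y))).
    by rewrite /A /C /D /delta /h -halfE !ReImE /=; field.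
  by rewrite /e -mulrA ler_wpM2l ?(ltW al0)//; lra.
have FE : (fun q => gfun alpha a c (toC q) * conjc (gfun alpha b d (toC q)) *
    (gdens alpha q)%:C) =
    (fun q => ((alpha / pi)%:C * cexp E0) * cgauss2 A C D x0 y0 q).
  apply/funext => -[x y].
  rewrite /gfun conjc_cexp /gdens [(_ * expR _)%:C]realCM -cexp_real.
  rewrite [LHS]mulrCA -[RHS]mulrA; congr (_ * _).
  rewrite -!cexpD /cgauss2; congr cexp.
  rewrite -[(x, y).1]/x -[(x, y).2]/y.
  have := @gauss_phaseE R[i] 'i%C alpha%:C a b' c delta z zeta x%:C y%:C (sqr_i R) Ezeta Ez.
  rewrite /= -/h /x0 /y0 opprK => <-.
  have -> : toC (x, y) = x%:C + 'i%C * y%:C by exact: complexE.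
  have JZ : conjc (x%:C + 'i%C * y%:C) = x%:C - 'i%C * y%:C :> R[i].
    by apply: complex_eq; rewrite !ReImE /=; ring.
  have -> : (- alpha * (x ^+ 2 + y ^+ 2))%:C = - (alpha%:C * (x%:C ^+ 2 + y%:C ^+ 2)) :> R[i].
    by apply: complex_eq; rewrite !ReImE; ring.
  rewrite conjcD !conjcM !conjc_real JZ realCM halfE -/b' -/delta -/h.
  by move: (x%:C + _) (x%:C - _) => Z Z'; ring.
have int2 := cint_cgauss2 x0 y0 e0 pos_form.
have -> : ipr alpha (gfun alpha a c) (gfun alpha b d) =
    (alpha / pi)%:C * cexp E0 * cint (leb \x leb)%E (cgauss2 A C D x0 y0).
  rewrite -cintZl; last exact: (cintegrable_cgauss2 x0 y0 e0 pos_form).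
  by rewrite -FE.
move: (cint _ _) int2 => J int2.
(* The source of [1 - c delta] is [(c + delta)^2 - (c - delta)^2 = 4 c delta]. *)
have ADC : A * D - C ^+ 2 = alpha%:C ^+ 2 * (1 - c * delta).
  by rewrite /A /D /C /h; field: (sqr_i R).
have nal : alpha%:C != 0 :> R[i] by rewrite (inj_eq (@complexI R)) gt_eqF.
have npi : pi%:C != 0 :> R[i] by rewrite (inj_eq (@complexI R)) gt_eqF// pi_gt0.
have -> : (alpha / pi)%:C = alpha%:C / pi%:C :> R[i] by rewrite realCM fmorphV.
move: (pi%:C : R[i]) npi int2 => P npi int2.
have -> : (alpha%:C / P * cexp E0 * J) ^+ 2 * (1 - c * conjc d) =
    cexp E0 ^+ 2 / P ^+ 2 * (J ^+ 2 * (A * D - C ^+ 2)).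
  by rewrite ADC -/delta; field.
rewrite int2 divfK ?expf_neq0// cexp_sqr; congr cexp.
by rewrite /E0 /h; field.
Qed.

Lemma ipr_gfun_norm alpha a b c d z zeta : 0 < alpha ->
  normc c < 1 -> normc d < 1 ->
  zeta = a + c * z -> z = conjc b + conjc d * zeta ->
  normc (ipr alpha (gfun alpha a c) (gfun alpha b d)) ^+ 2 =
  expR (alpha * Re (a * z + conjc b * zeta)) / normc (1 - c * conjc d).
Proof.
move=> al0 c1 d1 Ezeta Ez.
have n0 : normc (1 - c * conjc d) != 0.
  by rewrite normc_eq0 one_sub_neq0// normcJ.
have := congr1 (@Normc.normc _) (ipr_gfun_sqr al0 c1 d1 Ezeta Ez).
rewrite Normc.normcM expr2 Normc.normcM -expr2 normc_cexp [Re (alpha%:C * _)]ReM ReC ImC mul0r subr0.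
by move=> <-; rewrite mulfK.
Qed.

(** With [be = alpha s / 2], [|gfun alpha a c|^s = |gfun be a c|^2], so the norm integral is a
    diagonal pairing, whose critical point has [zeta = conj z]. *)
Lemma lpnorm_gfun_sqr alpha s a c z : 0 < alpha -> 0 < s -> normc c < 1 ->
  conjc z = a + c * z ->
  lpnorm s alpha (gfun alpha a c) ^+ 2 =
  expR (alpha * Re (a * z)) * (1 - normc c ^+ 2) `^ (- s^-1).
Proof.
move=> al0 s0 c1 Ez.
pose be := alpha * s / 2.
have be0 : 0 < be by rewrite divr_gt0// mulr_gt0.
pose F (q : R * R) := gfun be a c (toC q) * conjc (gfun be a c (toC q)) * (gdens be q)%:C.
have FE q : F q = ((normc (gfun alpha a c (toC q))) `^ s * gdens be q)%:C.
  rewrite realCM /F; congr (_ * _).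
  rewrite /gfun conjc_cexp -cexpD normc_cexp powR_expR -cexp_real; congr cexp.
  by apply: complex_eq; rewrite /be !ReImE; field.
pose I := ipr be (gfun be a c) (gfun be a c).
have IE : I = cint (leb \x leb)%E F by [].
have I2 : Im I = 0.
  rewrite IE /cint /= /comp; under eq_Rintegral do rewrite FE /=.
  by rewrite Rintegral_cst// mul0r.
have I1 : fine (\int[@lamC R]_(q in setT)
    ((normc (gfun alpha a c (toC q))) `^ s * gdens be q)%:E) = Re I.
  rewrite IE; congr fine; apply: eq_integral => q _.
  by rewrite -[RHS]/((Re (F q))%:E) FE.
have Ige0 : 0 <= Re I.
  rewrite -I1 fine_ge0// integral_ge0// => q _; rewrite lee_fin mulr_ge0 ?powR_ge0//.
  by rewrite /gdens mulr_ge0 ?expR_ge0// divr_ge0 ?pi_ge0// ltW.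
have nI : normc I = Re I by rewrite normcE I2 expr0n addr0 sqrtr_sqr ger0_norm.
have Ez' : z = conjc a + conjc c * conjc z.
  by rewrite -[LHS]conjcK [in LHS]Ez rmorphD rmorphM.
have := ipr_gfun_norm be0 c1 c1 Ez Ez'; rewrite -/I nI => I12.
(* The powers [s^-1] and 2 are exchanged, since it is the square of the pairing that is known in
   closed form. *)
rewrite /lpnorm -/be I1 -powR_mulrn ?powR_ge0// -powRrM [_ * 2%:R]mulrC powRrM.
rewrite powR_mulrn// I12 normc_one_sub_mulcJ//.
have c2 : 0 < 1 - normc c ^+ 2 by rewrite subr_gt0 expr_lt1 ?normc_ge0.
rewrite powRM ?expR_ge0 ?invr_ge0 ?(ltW c2)// powR_expR.
rewrite -[(1 - _)^-1]powR_inv1 ?(ltW c2)// -powRrM mulN1r.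
congr (expR _ * _); rewrite ReD -rmorphM /= ReJ /be; field.
by rewrite gt_eqF.
Qed.

(* The gap is (1 - |c|^2) |z1 - z|^2 / 2. *)
Lemma Re_phase_ge a c z zeta z1 : normc c <= 1 ->
  zeta = a + c * z -> conjc z1 = a + c * z1 ->
  Re (z * zeta) - Re (c * z ^+ 2) + (normc zeta ^+ 2 - normc z ^+ 2) / 2 <= Re (a * z1).
Proof.
move=> c1 Ezeta E1.
have -> : a = conjc z1 - c * z1 by rewrite E1 addrK.
have -> : zeta = conjc z1 - c * (z1 - z).
  by rewrite Ezeta E1; ring.
rewrite -subr_ge0; set D := (X in 0 <= X).
have -> : D = (1 - normc c ^+ 2) * normc (z1 - z) ^+ 2 / 2.
  by rewrite /D !normc_sqr !ReImE; field.
rewrite divr_ge0// mulr_ge0 ?sqr_ge0// subr_ge0 expr_le1// normc_ge0//.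
Qed.

(** Add the comparison for [(a, c)] at [z] to the one for [(b, d)] at [conj zeta]: the halves of
    [|zeta|^2 - |z|^2] cancel and the rest is the critical value. *)
Lemma Re_phase_le a b c d z zeta z1 z2 : normc c <= 1 -> normc d <= 1 ->
  zeta = a + c * z -> z = conjc b + conjc d * zeta ->
  conjc z1 = a + c * z1 -> conjc z2 = b + d * z2 ->
  Re (a * z + conjc b * zeta) <= Re (a * z1) + Re (b * z2).
Proof.
move=> c1 d1 Ezeta Ez E1 E2.
have h1 := Re_phase_ge c1 Ezeta E1.
have Ez' : conjc z = b + d * conjc zeta by rewrite Ez rmorphD rmorphM /= !conjcK.
have h2 := Re_phase_ge d1 Ez' E2.
have -> : Re (a * z + conjc b * zeta) =
    Re (z * zeta) - Re (c * z ^+ 2) + (Re (z * zeta) - Re (conjc d * zeta ^+ 2)).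
  have {1}-> : a = zeta - c * z by rewrite Ezeta addrK.
  have {1}-> : conjc b = z - conjc d * zeta by rewrite {1}Ez addrK.
  by rewrite !ReImE; ring.
have e1 : Re (conjc zeta * conjc z) = Re (z * zeta) by rewrite -rmorphM /= ReJ mulrC.
have e2 : Re (d * conjc zeta ^+ 2) = Re (conjc d * zeta ^+ 2).
  by rewrite !ReImE; ring.
move: h1 h2; rewrite !normcJ e1 e2; lra.
Qed.

(** Conjugating the equation and substituting it back makes it linear in [z] with coefficient
    [1 - |c|^2]. *)
Lemma conj_fixpoint a c : normc c < 1 -> exists z, conjc z = a + c * z.
Proof.
move=> c1; have n0 : 1 - c * conjc c != 0 by rewrite one_sub_neq0// normcJ.
exists ((conjc a + conjc c * a) / (1 - c * conjc c)).
have nJ : conjc (1 - c * conjc c) = 1 - c * conjc c.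
  by apply: complex_eq; rewrite !ReImE; ring.
rewrite rmorphM fmorphV /= nJ rmorphD rmorphM /= !conjcK; move: (conjc c) (conjc a) n0 => c' a' n0.
by field.
Qed.

Lemma critical_point a b c d : normc c < 1 -> normc d < 1 ->
  exists z zeta, zeta = a + c * z /\ z = conjc b + conjc d * zeta.
Proof.
move=> c1 d1; have n0 : 1 - c * conjc d != 0 by rewrite one_sub_neq0// normcJ.
move: (conjc d) (conjc b) n0 => d' b' n0.
exists ((b' + d' * a) / (1 - c * d')), (a + c * ((b' + d' * a) / (1 - c * d'))).
by split=> //; field.
Qed.

Lemma Rratio_sqr p alpha a b c d z zeta z1 z2 : 0 < alpha -> 1 < p ->
  normc c < 1 -> normc d < 1 ->
  zeta = a + c * z -> z = conjc b + conjc d * zeta ->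
  conjc z1 = a + c * z1 -> conjc z2 = b + d * z2 ->
  Rratio p alpha (gfun alpha a c) (gfun alpha b d) ^+ 2 =
  expR (alpha * (Re (a * z + conjc b * zeta) - (Re (a * z1) + Re (b * z2)))) *
  ((1 - normc c ^+ 2) `^ p^-1 * (1 - normc d ^+ 2) `^ (conjexp p)^-1
   / normc (1 - c * conjc d)).
Proof.
move=> al0 p1 c1 d1 Ezeta Ez E1 E2.
have p0 : 0 < p by rewrite (lt_trans _ p1).
have q0 : 0 < conjexp p by rewrite divr_gt0// subr_gt0.
rewrite /Rratio.
have := lpnorm_gfun_sqr al0 q0 d1 E2; have := lpnorm_gfun_sqr al0 p0 c1 E1.
have := ipr_gfun_norm al0 c1 d1 Ezeta Ez.
move: (normc (ipr alpha (gfun alpha a c) (gfun alpha b d)))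
  (lpnorm p alpha (gfun alpha a c)) (lpnorm (conjexp p) alpha (gfun alpha b d)) => N L1 L2 hN h1 h2.
rewrite exprMn exprVn exprMn hN h1 h2 !powRN {N L1 L2 hN h1 h2}.
rewrite mulrBr mulrDr expRD expRN expRD.
have n0 : normc (1 - c * conjc d) != 0 by rewrite normc_eq0 one_sub_neq0// normcJ.
have e1 := expR_gt0 (alpha * Re (a * z1)); have e2 := expR_gt0 (alpha * Re (b * z2)).
have pc : 0 < (1 - normc c ^+ 2) `^ p^-1.
  by rewrite powR_gt0// subr_gt0 expr_lt1 ?normc_ge0.
have pd : 0 < (1 - normc d ^+ 2) `^ (conjexp p)^-1.
  by rewrite powR_gt0// subr_gt0 expr_lt1 ?normc_ge0.
move: (expR (alpha * Re (a * z1))) (expR (alpha * Re (b * z2)))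
  ((1 - normc c ^+ 2) `^ p^-1) ((1 - normc d ^+ 2) `^ (conjexp p)^-1)
  (normc (1 - c * conjc d)) e1 e2 pc pd n0 => e1 e2 P Q n e10 e20 P0 Q0 n0.
by move: (expR _) => e; field; rewrite n0 !gt_eqF.
Qed.

End GaussianPairings.

(** * The two-variable inequality behind the constant, and its sharpness *)

Section SharpConstant.
Variable R : realType.
Variables p q : R.
Hypotheses (p0 : 0 < p) (q0 : 0 < q) (PQ : p^-1 + q^-1 = 1).
(** Equals [Cp p] when [q] is [conjexp p]. *)
Let K : R := 2 * p `^ (- p^-1) * q `^ (- q^-1).

(* Weighted AM-GM for p (1 - s^2) and q (1 - t^2). *)
Lemma conjugate_powR_le (s t : R) : 0 <= s < 1 -> 0 <= t < 1 ->
  (1 - s ^+ 2) `^ p^-1 * (1 - t ^+ 2) `^ q^-1 <= K * (1 - s * t).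
Proof.
move=> /andP[s0 s1] /andP[t0 t1].
have s2 : 0 <= 1 - s ^+ 2 by rewrite subr_ge0 expr_le1// ltW.
have t2 : 0 <= 1 - t ^+ 2 by rewrite subr_ge0 expr_le1// ltW.
have P0 : 0 < p `^ p^-1 by rewrite powR_gt0.
have Q0 : 0 < q `^ q^-1 by rewrite powR_gt0.
have := conjugate_powR (powR_ge0 (p * (1 - s ^+ 2)) p^-1)
  (powR_ge0 (q * (1 - t ^+ 2)) q^-1) p0 q0 PQ.
rewrite -!powRrM !mulVf ?(gt_eqF p0) ?(gt_eqF q0)// !powRr1; last 2 first.
- by rewrite mulr_ge0// ltW.
- by rewrite mulr_ge0// ltW.
rewrite [p * _]mulrC [q * _]mulrC !mulfK ?(gt_eqF p0) ?(gt_eqF q0)//.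
rewrite !powRM ?(ltW p0) ?(ltW q0)// => h.
rewrite /K !powRN.
have -> : 2 * (p `^ p^-1)^-1 * (q `^ q^-1)^-1 * (1 - s * t) =
    2 * (1 - s * t) / (p `^ p^-1 * q `^ q^-1).
  by field; rewrite !gt_eqF.
rewrite ler_pdivlMr ?mulr_gt0//.
(* AM-GM gives the bound [2 - s^2 - t^2], which is at most [2 (1 - s t)]. *)
have := sqr_ge0 (s - t); move: h.
by rewrite mulrACA; nra.
Qed.

(* The points s = 1 - e/p, t = 1 - e/q make AM-GM asymptotically sharp. *)
Lemma conjugate_powR_ge (e s t : R) : 0 < e < 1 -> s = 1 - e / p -> t = 1 - e / q ->
  K * (1 - e / 2) * (1 - s * t) <=
  (1 - s ^+ 2) `^ p^-1 * (1 - t ^+ 2) `^ q^-1.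
Proof.
move=> /andP[e0 e1] sE tE.
have iP0 : 0 < p^-1 by rewrite invr_gt0.
have iQ0 : 0 < q^-1 by rewrite invr_gt0.
have -> : 1 - s ^+ 2 = p^-1 * (e * (2 - e / p)) by rewrite sE; field; rewrite gt_eqF.
have -> : 1 - t ^+ 2 = q^-1 * (e * (2 - e / q)).
  by rewrite tE; field; rewrite gt_eqF.
have P1 : p^-1 <= 1 by rewrite -PQ lerDl ltW.
have Q1 : q^-1 <= 1 by rewrite -PQ lerDr ltW.
have ep : e / p <= e by rewrite ler_piMr// ltW.
have eq : e / q <= e by rewrite ler_piMr// ltW.
have ep0 : 0 < e / p by rewrite divr_gt0.
have eq0 : 0 < e / q by rewrite divr_gt0.
have p2 : 0 <= 2 - e / p by lra.
have q2 : 0 <= 2 - e / q by lra.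
rewrite !powRM ?mulr_ge0 ?(ltW e0) ?(ltW iP0) ?(ltW iQ0)//.
have -> : p^-1 `^ p^-1 = p `^ (- p^-1) by rewrite -powR_inv1 ?(ltW p0)// -powRrM mulN1r.
have -> : q^-1 `^ q^-1 = q `^ (- q^-1) by rewrite -powR_inv1 ?(ltW q0)// -powRrM mulN1r.
have ee : e `^ p^-1 * e `^ q^-1 = e.
  by rewrite -powRD ?PQ ?powRr1 ?(ltW e0)// oner_eq0.
(* Both bases are at least [2 - e], and the exponents sum to 1. *)
have two : 2 - e <= (2 - e / p) `^ p^-1 * (2 - e / q) `^ q^-1.
  have -> : 2 - e = (2 - e) `^ p^-1 * (2 - e) `^ q^-1.
    rewrite -powRD ?PQ ?powRr1//; first by lra.
    by rewrite oner_eq0.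
  rewrite ler_pM ?powR_ge0//; apply: ge0_ler_powR; rewrite ?nnegrE ?(ltW iP0) ?(ltW iQ0)//; lra.
have epq : e / p + e / q = e by rewrite -mulrDr PQ mulr1.
(* So [1 - s t] is below [e] by a second-order term only. *)
have stE : 1 - s * t = e - e / p * (e / q).
  have -> : 1 - s * t = (e / p + e / q) - e / p * (e / q) by rewrite sE tE; ring.
  by rewrite epq.
have pq0 : 0 < e / p * (e / q) by rewrite mulr_gt0.
have pq1 : e / p * (e / q) <= e / p by rewrite ler_piMr ?(ltW ep0)//; lra.
have st : 1 - s * t <= e by rewrite stE; lra.
have -> : p `^ (- p^-1) * (e `^ p^-1 * (2 - e / p) `^ p^-1) *
   (q `^ (- q^-1) * (e `^ q^-1 * (2 - e / q) `^ q^-1)) =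
   p `^ (- p^-1) * q `^ (- q^-1) * ((e `^ p^-1 * e `^ q^-1) *
    ((2 - e / p) `^ p^-1 * (2 - e / q) `^ q^-1)) by ring.
rewrite ee /K.
have -> : 2 * p `^ (- p^-1) * q `^ (- q^-1) * (1 - e / 2) * (1 - s * t) =
  p `^ (- p^-1) * q `^ (- q^-1) * ((1 - s * t) * (2 - e)) by field.
rewrite ler_wpM2l ?mulr_ge0 ?powR_ge0// ler_pM//; last by lra.
by rewrite stE; lra.
Qed.

End SharpConstant.

(** * Upper bound for the ratio and near-extremal pairs *)

Section SupremumBounds.
Variable R : realType.
Variables alpha p : R.
Hypotheses (al0 : 0 < alpha) (p1 : 1 < p).

Let p0 : 0 < p. Proof. exact: lt_trans p1. Qed.

Let q0 : 0 < conjexp p. Proof. by rewrite divr_gt0// subr_gt0. Qed.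

Let conjexpV : p^-1 + (conjexp p)^-1 = 1.
Proof. by rewrite /conjexp; field; rewrite subr_eq0 !gt_eqF. Qed.

Let Cp_gt0 : 0 < Cp p. Proof. by rewrite !mulr_gt0// powR_gt0. Qed.

Lemma Rratio_ge0 (g h : R[i] -> R[i]) : 0 <= Rratio p alpha g h.
Proof. by rewrite divr_ge0 ?normc_ge0// mulr_ge0// powR_ge0. Qed.

Lemma Rratio_le (g h : R[i] -> R[i]) : Galpha alpha g -> Galpha alpha h ->
  Rratio p alpha g h <= Num.sqrt (Cp p).
Proof.
move=> [a [c [c1 ->]]] [b [d [d1 ->]]].
have [z [zeta [Ezeta Ez]]] := critical_point a b c1 d1.
have [z1 E1] := conj_fixpoint a c1; have [z2 E2] := conj_fixpoint b d1.
rewrite -(ger0_norm (Rratio_ge0 _ _)) -sqrtr_sqr ler_wsqrtr//.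
rewrite (Rratio_sqr al0 p1 c1 d1 Ezeta Ez E1 E2).
set B := (X in _ * X).
have n0 : 0 < normc (1 - c * conjc d).
  by rewrite lt0r normc_ge0 normc_eq0 one_sub_neq0 ?normcJ.
have B0 : 0 <= B by rewrite divr_ge0 ?mulr_ge0 ?powR_ge0 ?normc_ge0.
have e1 : expR (alpha * (Re (a * z + conjc b * zeta) - (Re (a * z1) + Re (b * z2)))) <= 1.
  rewrite -expR0 ler_expR pmulr_rle0// subr_le0.
  by apply: (Re_phase_le _ _ Ezeta Ez E1 E2); exact: ltW.
apply: le_trans (ler_wpM2r B0 e1) _; rewrite mul1r ler_pdivrMr//.
apply: le_trans (conjugate_powR_le p0 q0 conjexpV _ _) _; rewrite ?normc_ge0//.
rewrite ler_wpM2l ?(ltW Cp_gt0)//.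
(* The triangle inequality gives [1 - |c| |d| <= |1 - c conj d|], which reduces complex parameters
   to their moduli. *)
have := le_normcD (1 - c * conjc d) (c * conjc d).
by rewrite subrK normc1 Normc.normcM normcJ lerBlDr.
Qed.

(** For [a = b = 0] all critical points are 0, so the exponential factor is 1. *)
Lemma Rratio_sqr_real (s t : R) : 0 <= s < 1 -> 0 <= t < 1 ->
  Rratio p alpha (gfun alpha 0 s%:C) (gfun alpha 0 t%:C) ^+ 2 =
  (1 - s ^+ 2) `^ p^-1 * (1 - t ^+ 2) `^ (conjexp p)^-1 / (1 - s * t).
Proof.
move=> /andP[s0 s1] /andP[t0 t1].
have ns : normc s%:C = s by rewrite normc_real ger0_norm.
have nt : normc t%:C = t by rewrite normc_real ger0_norm.
have c1 : normc s%:C < 1 by rewrite ns.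
have d1 : normc t%:C < 1 by rewrite nt.
have E (c : R[i]) : 0 = 0 + c * 0 by rewrite mulr0 addr0.
have E' (c : R[i]) : 0 = conjc 0 + conjc c * 0 by rewrite mulr0 addr0 conjc0.
have E'' (c : R[i]) : conjc 0 = 0 + c * 0 by rewrite mulr0 addr0 conjc0.
rewrite (Rratio_sqr al0 p1 c1 d1 (E _) (E' _) (E'' _) (E'' _)) ns nt.
rewrite !(mulr0, addr0, Re0, subr0) expR0 mul1r conjc_real -realCM.
have -> : 1 - (s * t)%:C = (1 - s * t)%:C :> R[i].
  by apply: complex_eq; rewrite !ReImE ?subr0.
by rewrite normc_real ger0_norm// subr_ge0 mulr_ile1// ltW.
Qed.

Lemma Rratio_near (e : R) : 0 < e < 1 -> exists g h,
  [/\ Galpha alpha g, Galpha alpha h &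
      Num.sqrt (Cp p) * (1 - e / 2) <= Rratio p alpha g h].
Proof.
move=> /andP[e0 e1].
have e01 : 0 < e < 1 by rewrite e0.
have iP0 : 0 < p^-1 by rewrite invr_gt0.
have iQ0 : 0 < (conjexp p)^-1 by rewrite invr_gt0.
have P1 : p^-1 <= 1 by rewrite -conjexpV lerDl ltW.
have Q1 : (conjexp p)^-1 <= 1 by rewrite -conjexpV lerDr ltW.
have ep : e / p <= e by rewrite ler_piMr// ltW.
have eq : e / conjexp p <= e by rewrite ler_piMr// ltW.
have ep0 : 0 < e / p by rewrite divr_gt0.
have eq0 : 0 < e / conjexp p by rewrite divr_gt0.
pose s := 1 - e / p; pose t := 1 - e / conjexp p.
have s01 : 0 <= s < 1 by rewrite /s; lra.
have t01 : 0 <= t < 1 by rewrite /t; lra.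
exists (gfun alpha 0 s%:C), (gfun alpha 0 t%:C); split.
- by exists 0, s%:C; split => //; rewrite normc_real ger0_norm; lra.
- by exists 0, t%:C; split => //; rewrite normc_real ger0_norm; lra.
rewrite -ler_sqr ?nnegrE ?Rratio_ge0 ?mulr_ge0 ?sqrtr_ge0//; last by lra.
rewrite Rratio_sqr_real// exprMn sqr_sqrtr ?(ltW Cp_gt0)//.
have st : 0 < 1 - s * t.
  by move: s01 t01 => /andP[? ?] /andP[? ?]; rewrite subr_gt0 mulr_ilt1.
rewrite ler_pdivlMr//.
apply: le_trans (conjugate_powR_ge p0 q0 conjexpV e01 erefl erefl).
rewrite -/s -/t -/(Cp p) ler_wpM2r ?(ltW st)// ler_wpM2l ?(ltW Cp_gt0)//.
(* The sharp bound for the squared ratio loses a factor [1 - e / 2]; the claim, once squared, allows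
   its square, which is smaller. *)
by rewrite expr2 ler_piMr; lra.
Qed.

End SupremumBounds.

Theorem theorem5p2 (R : realType) (alpha p : R) (halpha : 0 < alpha) (hp : 1 < p) :
  ereal_sup [set (Rratio p alpha g h)%:E | g in Galpha alpha & h in Galpha alpha]
  = (Num.sqrt (Cp p))%:E.
Proof.
apply/eqP; rewrite eq_le; apply/andP; split.
  apply: ge_ereal_sup => _ [g Gg [h Gh <-]].
  by rewrite lee_fin Rratio_le.
set S := ereal_sup _; set r := Num.sqrt (Cp p).
have r0 : 0 <= r by exact: sqrtr_ge0.
apply/lee_addgt0Pr => e e0.
(* The second entry makes the loss [r d / 2] at most [e], with [r + 1] as a nonzero denominator; the
   first keeps [d] below 1. *)
pose d := Num.min 2^-1 (e / (r + 1)).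
have d0 : 0 < d by rewrite lt_min invr_gt0 ltr0n divr_gt0// ltr_wpDl.
have d1 : d < 1 by rewrite gt_min invf_lt1// ltr1n.
have dr : r * (d / 2) <= e.
  have : d * (r + 1) <= e by rewrite -ler_pdivlMr ?ltr_wpDl// ge_min lexx orbT.
  have : 0 <= r * d by rewrite mulr_ge0// ltW.
  lra.
have [|g [h [Gg Gh gh]]] := Rratio_near halpha hp (e := d); first by rewrite d0.
have : ((Rratio p alpha g h)%:E <= S)%E.
  by apply: ereal_sup_ubound; exists g => //; exists h.
move=> /(leeD2r e%:E); apply: le_trans.
by rewrite -EFinD lee_fin; move: gh; rewrite -/r; lra.
Qed.
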